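(* Let $A=\mathsf{k}Q/I$ be a cluster-tilted algebra of type $\mathbb{A}$. Then $A$ has finite Frobenius dimension. Moreover, $$\operatorname{Frobdim}(A)=\sharp\,\mathcal{B}+\sum_{b\in\mathcal{V_S}}\ell_{\rightarrow b}\cdot\ell_{\leftarrow b},$$ where $\mathcal{V_S}$ is the set of special vertices of $Q$, $\mathcal{B}$ is the set of basis paths, $\ell_{\rightarrow b}$ is the length of the longest path with target $b$ and $\ell_{\leftarrow b}$ is the length of the longest path with source $b$.
   Context: $\mathsf{k}$ is an algebraically closed field. For a quiver $Q$ with arrows $\alpha\colon s(\alpha)\to t(\alpha)$, paths are composed left to right ($\alpha\beta$ is defined when $t(\alpha)=s(\beta)$) and $e_x$ is the stationary path at $x$. Open Frobenius structures: for a $\mathsf{k}$-algebra $A$ with multiplication $m\colon A\otimes A\to A$, an open Frobenius coproduct is a $\mathsf{k}$-linear map $\Delta\colon A\to A\otimes A$ which is a morphism of $A$-bimodules, i.e. $(m\otimes 1)(1\otimes\Delta)=\Delta\circ m=(1\otimes m)(\Delta\otimes 1)$. These maps form a $\mathsf{k}$-vector space; its dimension is $\operatorname{Frobdim}(A)$. Cluster-tilted algebras of type $\mathbb{A}$: let $\mathcal{M}^A_k$ be the mutation class of $\mathbb{A}_k$, i.e. the set of connected quivers with $k$ vertices such that: all non-trivial cycles (of the underlying graph) are 3-cycles, where a 3-cycle means an oriented cycle of length 3; every vertex has valency at most four; if a vertex has valency four, then two of its adjacent arrows belong to one 3-cycle and the other two belong to another 3-cycle; if a vertex has valency three, then two of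 its adjacent arrows belong to a 3-cycle and the third arrow belongs to no 3-cycle. $A=\mathsf{k}Q/I$ is cluster-tilted of type $\mathbb{A}_k$ iff $Q\in\mathcal{M}^A_k$ and $I$ is generated by all compositions of two consecutive arrows of 3-cycles (every 3-cycle is ''saturated''). Type $\mathbb{A}$ means type $\mathbb{A}_k$ for some $k$. Special vertex: a vertex $v$ of valency two for which there are arrows $\alpha,\beta$ with $t(\alpha)=s(\beta)=v$ and $\alpha\beta\in I$. Basis path: a path $v\rightsquigarrow v'$ such that each of $v,v'$ is either a special vertex, or a source or sink of valency one. Here, in the definitions of $\mathcal B$, $\ell_{\rightarrow b}$ and $\ell_{\leftarrow b}$, ''path'' means a path of positive length that is nonzero in $A$.
   Formalization: The dimension formula is stated only for type A_k with k > 1: for k = 1 the algebra is the field k itself, with Frobenius dimension 1, while the right-hand side is 0; finiteness of the Frobenius dimension is stated for all k ≥ 1. *)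

(* Defs.v *)
From HB Require Import structures.
From mathcomp Require Import all_boot all_order all_algebra.
From mathcomp Require Import ring_quotient.
From mathcomp Require Import finmap.
From mathcomp Require Import boolp classical_sets functions cardinality.
From mathcomp.multinomials Require Import monalg.

Set Implicit Arguments.
Unset Strict Implicit.
Unset Printing Implicit Defensive.

Import GRing.Theory.
Import Quotient.

Local Open Scope ring_scope.
Local Open Scope quotient_scope.

Section LinearExtension.
Variables (K : fieldType) (T : choiceType) (V : lmodType K).
Implicit Types (h : T -> V) (g : {malg K[T]}).

Definition mlift h g : V := \sum_(t <- msupp g) g@_t *: h t.

Lemma mliftEw h g (d : {fset T}) : (msupp g `<=` d)%fset ->
  mlift h g = \sum_(t <- d) g@_t *: h t.
Proof.
move=> sub; rewrite /mlift; apply: big_fset_incl => // t _ /mcoeff_outdom ->.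
by rewrite scale0r.
Qed.

Lemma mlift_is_linear h : linear (mlift h).
Proof.
move=> a x y; pose d := (msupp x `|` msupp y)%fset.
have sd : (msupp (a *: x + y) `<=` d)%fset.
  apply: fsubset_trans (msuppD_le _ _) _.
  exact: fsetSU (msuppZ_le _ _).
rewrite (mliftEw _ sd) (@mliftEw h x d) ?fsubsetUl //.
rewrite (@mliftEw h y d) ?fsubsetUr // scaler_sumr -big_split /=.
by apply: eq_bigr => t _; rewrite mcoeffD mcoeffZ scalerDl scalerA.
Qed.

HB.instance Definition _ h :=
  GRing.isLinear.Build K {malg K[T]} V _ (mlift h) (mlift_is_linear h).

Lemma mliftU h t : mlift h << t >> = h t.
Proof. by rewrite /mlift msuppU oner_eq0 big_seq_fset1 mcoeffUU scale1r. Qed.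

Lemma malg_linE (f : {linear {malg K[T]} -> V}) g :
  f g = mlift (fun t => f << t >>) g.
Proof.
rewrite {1}[g]monalgE linear_sum; apply: eq_bigr => t _.
rewrite -linearZ; congr (f _); apply/malgP => u.
by rewrite mcoeffZ !mcoeffU mulr_natr.
Qed.

Lemma mlift_ext h h' : h =1 h' -> mlift h =1 mlift h'.
Proof. by move=> e g; apply: eq_bigr => t _; rewrite e. Qed.

Lemma mlift_linl a h h' g :
  mlift (fun t => a *: h t + h' t) g = a *: mlift h g + mlift h' g.
Proof.
rewrite scaler_sumr -big_split; apply: eq_bigr => t _ /=.
by rewrite scalerDr !scalerA mulrC.
Qed.

End LinearExtension.

Lemma mlift_comp (K : fieldType) (T : choiceType) (V W : lmodType K)
    (f : {linear V -> W}) (h : T -> V) g : f (mlift h g) = mlift (f \o h) g.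
Proof.
by rewrite linear_sum; apply: eq_bigr => t _; rewrite linearZ.
Qed.

Lemma malg_scaleU (K : fieldType) (T : choiceType) (t : T) (c : K) :
  c *: (<< t >> : {malg K[T]}) = << c *g t >>.
Proof. by apply/malgP => u; rewrite mcoeffZ !mcoeffU mulr_natr. Qed.

Section LmodQuotient.
Variables (K : fieldType) (V : lmodType K) (J : submodClosed V).

Definition as_pred : {pred V} := J.

(* On an [lmodType], [submodClosed] does not record closure under opposites. *)
Lemma as_pred_submod : submod_closed as_pred.
Proof. exact: submodClosedP. Qed.
HB.instance Definition _ := GRing.isSubmodClosed.Build K V as_pred as_pred_submod.

Definition lquot := {quot as_pred}.
HB.instance Definition _ := GRing.Zmodule.on lquot.
HB.instance Definition _ := EqQuotient.on lquot.

Definition lpi (x : V) : lquot := \pi_lquot x.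

Lemma lpiP x y : reflect (lpi x = lpi y) (x - y \in J).
Proof.
by rewrite -[x - y \in J]/(x - y \in as_pred) idealrBE; apply: eqP.
Qed.

Lemma lpi_repr q : lpi (repr q) = q.
Proof. exact: reprK. Qed.

Lemma lpiD x y : lpi (x + y) = lpi x + lpi y.
Proof. exact: (@pi_add _ as_pred). Qed.

Lemma repr_lpi x : repr (lpi x) - x \in J.
Proof. by apply/lpiP; rewrite lpi_repr. Qed.

Lemma lpi_repr_sub x : x - repr (lpi x) \in J.
Proof. by apply/lpiP; rewrite lpi_repr. Qed.

Definition lquot_scale (a : K) (q : lquot) : lquot := lpi (a *: repr q).

Lemma lpiZ a x : lpi (a *: x) = lquot_scale a (lpi x).
Proof.
by apply/lpiP; rewrite -scalerBr rpredZ // lpi_repr_sub.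
Qed.

Lemma lquot_scaleA a b q :
  lquot_scale a (lquot_scale b q) = lquot_scale (a * b) q.
Proof. by rewrite -[q]lpi_repr -!lpiZ scalerA. Qed.

Lemma lquot_scale1 : left_id 1 lquot_scale.
Proof. by move=> q; rewrite -[q]lpi_repr -lpiZ scale1r. Qed.

Lemma lquot_scaleDr : right_distributive lquot_scale +%R.
Proof.
by move=> a p q; rewrite -[p]lpi_repr -[q]lpi_repr -lpiD -!lpiZ -lpiD scalerDr.
Qed.

Lemma lquot_scaleDl q : {morph lquot_scale^~ q : a b / a + b}.
Proof. by move=> a b; rewrite -[q]lpi_repr -!lpiZ -lpiD scalerDl. Qed.

HB.instance Definition _ := GRing.Zmodule_isLmodule.Build K lquot
  lquot_scaleA lquot_scale1 lquot_scaleDr lquot_scaleDl.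

Lemma lpi_is_linear : linear lpi.
Proof. by move=> a x y; rewrite lpiD lpiZ. Qed.

HB.instance Definition _ := GRing.isLinear.Build K V lquot _ lpi lpi_is_linear.

Lemma lpi_eq0 x : (lpi x == 0) = (x \in J).
Proof.
apply/eqP/idP => [|xJ].
  by rewrite -[0](linear0 lpi) => /lpiP; rewrite subr0.
by rewrite -[RHS](linear0 lpi); apply/lpiP; rewrite subr0.
Qed.

End LmodQuotient.

Definition ideal_closed (K : fieldType) (A : algType K) (S : {pred A}) :=
  submod_closed S /\ forall a x, x \in S -> a * x \in S /\ x * a \in S.

HB.mixin Record isProperTwoSided (K : fieldType) (A : algType K)
    (S : A -> bool) := {
  two_sided_subproof : forall a x, x \in S -> a * x \in S /\ x * a \in S;
  two_sided_proper_subproof : 1 \notin S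
}.

#[short(type="algIdeal")]
HB.structure Definition AlgIdeal (K : fieldType) (A : algType K) :=
  {S of GRing.SubmodClosed K S & isProperTwoSided K A S}.

Section AlgQuotient.
Variables (K : fieldType) (A : algType K) (J : algIdeal A).

Definition aquot := lquot J.
HB.instance Definition _ := GRing.Lmodule.on aquot.

Definition api (x : A) : aquot := lpi J x.

HB.instance Definition _ :=
  GRing.isLinear.Build K A aquot _ api (@lpi_is_linear K A J).

Lemma apiZ a x : api (a *: x) = a *: api x.
Proof. exact: linearZ. Qed.

Definition aquot_one : aquot := api 1.
Definition aquot_mul (p q : aquot) : aquot :=
  api (repr (p : lquot J) * repr (q : lquot J)).

Lemma api_surj q : exists x, q = api x.
Proof. by exists (repr (q : lquot J)); rewrite /api lpi_repr. Qed.

Lemma apiM x y : api (x * y) = aquot_mul (api x) (api y).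
Proof.
apply/lpiP; set x' := repr _; set y' := repr _.
have -> : x * y - x' * y' = (x - x') * y + x' * (y - y').
  by rewrite mulrBl mulrBr addrA subrK.
have xJ : x - x' \in J by apply: lpi_repr_sub.
have yJ : y - y' \in J by apply: lpi_repr_sub.
by rewrite rpredD // ?(two_sided_subproof y _ xJ).2
  ?(two_sided_subproof x' _ yJ).1.
Qed.

Lemma aquot_mulA : associative aquot_mul.
Proof.
move=> p q r; have [[[x ->] [y ->]] [z ->]] := (api_surj p, api_surj q, api_surj r).
by rewrite -!apiM mulrA.
Qed.

Lemma aquot_mul1 : left_id aquot_one aquot_mul.
Proof. by move=> p; have [x ->] := api_surj p; rewrite -apiM mul1r. Qed.

Lemma aquot_mulr1 : right_id aquot_one aquot_mul.
Proof. by move=> p; have [x ->] := api_surj p; rewrite -apiM mulr1. Qed.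

Lemma aquot_mulDl : left_distributive aquot_mul +%R.
Proof.
move=> p q r; have [[[x ->] [y ->]] [z ->]] := (api_surj p, api_surj q, api_surj r).
by rewrite -linearD -!apiM -linearD mulrDl.
Qed.

Lemma aquot_mulDr : right_distributive aquot_mul +%R.
Proof.
move=> p q r; have [[[x ->] [y ->]] [z ->]] := (api_surj p, api_surj q, api_surj r).
by rewrite -linearD -!apiM -linearD mulrDr.
Qed.

Lemma aquot_1_neq0 : aquot_one != 0.
Proof. by rewrite lpi_eq0 two_sided_proper_subproof. Qed.

HB.instance Definition _ := GRing.Zmodule_isNzRing.Build aquot
  aquot_mulA aquot_mul1 aquot_mulr1 aquot_mulDl aquot_mulDr aquot_1_neq0.

Lemma aquot_scaleAl (a : K) (p q : aquot) : a *: (p * q) = (a *: p) * q.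
Proof.
have [[x ->] [y ->]] := (api_surj p, api_surj q).
rewrite -[a *: api x]apiZ -[RHS]/(aquot_mul _ _) -[LHS]/(a *: aquot_mul _ _).
by rewrite -!apiM -apiZ scalerAl.
Qed.

HB.instance Definition _ :=
  GRing.Lmodule_isLalgebra.Build K aquot aquot_scaleAl.

Lemma aquot_scaleAr (a : K) (p q : aquot) : a *: (p * q) = p * (a *: q).
Proof.
have [[x ->] [y ->]] := (api_surj p, api_surj q).
rewrite -[a *: api y]apiZ -[RHS]/(aquot_mul _ _) -[LHS]/(a *: aquot_mul _ _).
by rewrite -!apiM -apiZ scalerAr.
Qed.

HB.instance Definition _ := GRing.Lalgebra_isAlgebra.Build K aquot aquot_scaleAr.

Lemma api_is_monoid_morphism : monoid_morphism api.
Proof. by split=> // x y; rewrite apiM. Qed.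

HB.instance Definition _ :=
  GRing.isMonoidMorphism.Build A aquot api api_is_monoid_morphism.

Lemma api_eq0 x : (api x == 0) = (x \in J).
Proof. exact: lpi_eq0. Qed.

End AlgQuotient.

Section LinearSpan.
Variables (K : fieldType) (V : lmodType K).

Definition lspan (S : set V) : {pred V} := fun x =>
  `[< forall W : {pred V}, submod_closed W -> (forall s, S s -> s \in W) ->
      x \in W >].

Lemma lspan_submod S : submod_closed (lspan S).
Proof.
split=> [|a x y /asboolP xS /asboolP yS]; apply/asboolP => W cW SW.
  exact: cW.1.
by apply: cW.2; [apply: xS | apply: yS].
Qed.

HB.instance Definition _ S :=
  GRing.isSubmodClosed.Build K V (lspan S) (lspan_submod S).

Lemma lspan_gen S s : S s -> s \in lspan S.
Proof. by move=> Ss; apply/asboolP => W _; apply. Qed.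

Lemma lspan_min S (W : {pred V}) : submod_closed W ->
  (forall s, S s -> s \in W) -> {subset lspan S <= W}.
Proof. by move=> cW SW x /asboolP; apply. Qed.

End LinearSpan.

Section Tensor.
Variables (K : fieldType) (U V : lmodType K).

Local Notation free := {malg K[(U * V)%type]}.
Local Notation "u @x v" := (<< (u, v) >> : free) (at level 30).

Definition bilinear_rels : set free := fun z =>
  (exists a u u' v,
     z = (a *: u + u') @x v - (a *: (u @x v) + u' @x v)) \/
  (exists a u v v',
     z = u @x (a *: v + v') - (a *: (u @x v) + u @x v')).

Definition tensor := lquot (lspan bilinear_rels).
HB.instance Definition _ := GRing.Lmodule.on tensor.

Definition tens (u : U) (v : V) : tensor := lpi (lspan bilinear_rels) (u @x v).

Lemma tens_linl v : linear (tens^~ v).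
Proof.
move=> a u u'; rewrite /tens -[a *: lpi _ _]linearZ -linearD; apply/lpiP.
by apply: lspan_gen; left; exists a, u, u', v.
Qed.

Lemma tens_linr u : linear (tens u).
Proof.
move=> a v v'; rewrite /tens -[a *: lpi _ _]linearZ -linearD; apply/lpiP.
by apply: lspan_gen; right; exists a, u, v, v'.
Qed.

Definition bilinear_map (W : lmodType K) (f : U -> V -> W) :=
  (forall v, linear (f^~ v)) /\ (forall u, linear (f u)).

(* The map out of the tensor product induced by [f]; it only has a meaning
   when [f] is bilinear (see [tliftE]). *)
Definition tlift (W : lmodType K) (f : U -> V -> W) (z : tensor) : W :=
  mlift (fun p => f p.1 p.2) (repr (z : lquot (lspan bilinear_rels))).

Lemma tlift_lpi (W : lmodType K) (f : U -> V -> W) z : bilinear_map f ->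
  tlift f (lpi (lspan bilinear_rels) z) = mlift (fun p => f p.1 p.2) z.
Proof.
move=> [fl fr]; apply/eqP; rewrite -subr_eq0 -linearB /=.
set y := _ - _; have: y \in lspan bilinear_rels by rewrite repr_lpi.
pose N : {pred free} := fun x => mlift (fun p => f p.1 p.2) x == 0.
apply: (@lspan_min K _ _ N) => [|s [] []].
- split=> [|a x x' /eqP xN /eqP x'N]; rewrite unfold_in.
    by rewrite linear0.
  by rewrite linearP /= xN x'N scaler0 addr0.
- move=> a [u [u' [v ->]]]; rewrite unfold_in linearB linearP /= !mliftU /=.
  by rewrite fl subrr.
- move=> a [u [v [v' ->]]]; rewrite unfold_in linearB linearP /= !mliftU /=.
  by rewrite fr subrr.
Qed.

Lemma tliftE (W : lmodType K) (f : U -> V -> W) u v : bilinear_map f ->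
  tlift f (tens u v) = f u v.
Proof. by move=> bf; rewrite tlift_lpi // mliftU. Qed.

Lemma tlift_is_linear (W : lmodType K) (f : U -> V -> W) :
  bilinear_map f -> linear (tlift f).
Proof.
move=> bf a x y; rewrite -[x]lpi_repr -[y]lpi_repr.
by rewrite -[LHS]/(tlift f (a *: lpi _ _ + lpi _ _)) -linearP !tlift_lpi // linearP.
Qed.

Lemma tens_ext (W : lmodType K) (f g : {linear tensor -> W}) :
  (forall u v, f (tens u v) = g (tens u v)) -> f =1 g.
Proof.
move=> fg z; rewrite -[z]lpi_repr; set y := repr _.
pose p : {linear free -> lquot (lspan bilinear_rels)} := lpi (lspan bilinear_rels).
rewrite -[lpi _ _]/(p y) (malg_linE p) -[LHS]/(f (mlift _ _)).
rewrite -[RHS]/(g (mlift (fun t => (p << t >> : tensor)) _)).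
rewrite !linear_sum; apply: eq_bigr => -[u v] _.
by rewrite !linearZ /=; congr (_ *: _); apply: fg.
Qed.

End Tensor.

Definition tmap (K : fieldType) (U V U' V' : lmodType K)
    (f : U -> U') (g : V -> V') : tensor U V -> tensor U' V' :=
  tlift (fun u v => tens (f u) (g v)).

Lemma tmapE (K : fieldType) (U V U' V' : lmodType K)
    (f : {linear U -> U'}) (g : {linear V -> V'}) u v :
  tmap f g (tens u v) = tens (f u) (g v).
Proof.
rewrite /tmap tliftE //; split=> [v'|u'] a x y; rewrite linearP.
  exact: (tens_linl (g v')).
exact: (tens_linr (f u')).
Qed.

Section Dimension.
Variables (K : fieldType) (V : lmodType K).

Definition has_dim (W : set V) (n : nat) :=
  exists e : 'I_n -> V,
    [/\ W = [set v | exists c : 'I_n -> K, v = \sum_i c i *: e i]%classic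
      & forall c : 'I_n -> K, \sum_i c i *: e i = 0 -> forall i, c i = 0].

Definition finite_dim (W : set V) := exists n, has_dim W n.

(* [0] when [W] is infinite-dimensional. *)
Definition dim (W : set V) : nat := xget 0%N (has_dim W).

End Dimension.

Section Frobenius.
Variables (K : fieldType) (A : algType K).

(* The outer bimodule structure of the tensor square:
   a . (x (x) y) = ax (x) y  and  (x (x) y) . b = x (x) yb. *)
Definition tens_lact (a : A) : tensor A A -> tensor A A := tmap ( *%R a) idfun.
Definition tens_ract (b : A) : tensor A A -> tensor A A :=
  tmap idfun (fun y => y * b).

Lemma tens_lactE a x y : tens_lact a (tens x y) = tens (a * x) y.
Proof.
rewrite /tens_lact /tmap tliftE //; split=> [v|u] c z z'.
  by rewrite mulrDr -scalerAr (tens_linl v).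
exact: (tens_linr (a * u)).
Qed.

Lemma tens_ractE b x y : tens_ract b (tens x y) = tens x (y * b).
Proof.
rewrite /tens_ract /tmap tliftE //; split=> [v|u] c z z'.
  exact: (tens_linl (v * b)).
by rewrite mulrDl -scalerAl (tens_linr u).
Qed.

Definition open_frobenius (D : A -> tensor A A) :=
  [/\ linear D,
      forall a b, D (a * b) = tens_lact a (D b)
    & forall a b, D (a * b) = tens_ract b (D a)].

Definition frobenius_space : set (A -> tensor A A) := [set D | open_frobenius D]%classic.

Definition Frobdim : nat := dim frobenius_space.

End Frobenius.

Arguments frobenius_space {K} A.
Arguments Frobdim {K} A.

(* Finite and with at least one vertex, so that the path algebra is a non-zero
   unital ring. *)
Record quiver := Quiver {
  vertex : finType;
  arrow : finType;
  src : arrow -> vertex;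
  tgt : arrow -> vertex;
  quiver_nonempty : (0 < #|vertex|)%N
}.

Section Paths.
Variable Q : quiver.

Fixpoint walk (x : vertex Q) (l : seq (arrow Q)) : bool :=
  if l is a :: l' then (src a == x) && walk (tgt a) l' else true.

(* A starting vertex followed by the arrows, from left to right. *)
Record qpath := QPath {
  qpath_val :> vertex Q * seq (arrow Q);
  _ : walk qpath_val.1 qpath_val.2
}.

HB.instance Definition _ := [isSub for qpath_val].
HB.instance Definition _ := [Choice of qpath by <:].

Definition psrc (p : qpath) : vertex Q := (p : vertex Q * _).1.
Definition parrows (p : qpath) : seq (arrow Q) := (p : vertex Q * _).2.
Definition ptgt (p : qpath) : vertex Q := last (psrc p) (map (@tgt Q) (parrows p)).
Definition plen (p : qpath) : nat := size (parrows p).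

Definition stationary (x : vertex Q) : qpath := @QPath (x, [::]) isT.

Lemma walk_arrow (a : arrow Q) : walk (src a) [:: a].
Proof. by rewrite /= eqxx. Qed.
Definition arrow_path (a : arrow Q) : qpath := @QPath (src a, [:: a]) (walk_arrow a).

Definition pcomp (p q : qpath) : option qpath :=
  if ptgt p == psrc q then insub (psrc p, parrows p ++ parrows q) else None.

Lemma walk_cat x l1 l2 :
  walk x (l1 ++ l2) = walk x l1 && walk (last x (map (@tgt Q) l1)) l2.
Proof. by elim: l1 x => //= a l IH x; rewrite IH andbA. Qed.

Lemma pcompP p q : ptgt p = psrc q ->
  exists2 r, pcomp p q = Some r &
    (psrc r = psrc p) /\ (parrows r = parrows p ++ parrows q).
Proof.
move=> e; rewrite /pcomp e eqxx.
have w : walk (psrc p) (parrows p ++ parrows q).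
  rewrite walk_cat (valP p) /=; rewrite -/(ptgt p) e; exact: (valP q).
by exists (QPath (qpath_val := (psrc p, _)) w) => //; rewrite insubT.
Qed.

Lemma pcompN p q : ptgt p <> psrc q -> pcomp p q = None.
Proof. by move=> /eqP/negbTE e; rewrite /pcomp e. Qed.

Lemma qpath_eq (p q : qpath) :
  psrc p = psrc q -> parrows p = parrows q -> p = q.
Proof.
move=> e1 e2; apply: val_inj; move: e1 e2; rewrite /psrc /parrows /=.
by case: (qpath_val p) (qpath_val q) => [x l] [y m] /= -> ->.
Qed.

Lemma ptgt_comp p q r : psrc r = psrc p -> parrows r = parrows p ++ parrows q ->
  ptgt p = psrc q -> ptgt r = ptgt q.
Proof. by move=> e1 e2 e3; rewrite /ptgt e1 e2 map_cat last_cat -e3. Qed.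

Lemma pcompA p q r :
  obind (fun z => pcomp z r) (pcomp p q) = obind (pcomp p) (pcomp q r).
Proof.
have [pq|pq] := ptgt p =P psrc q; last first.
  rewrite (pcompN pq) /=; have [qr|qr] := ptgt q =P psrc r; last by rewrite pcompN.
  by have [s -> [e _]] := pcompP qr; rewrite /= pcompN // e.
have [s -> [s1 s2]] /= := pcompP pq; have st := ptgt_comp s1 s2 pq.
have [qr|qr] := ptgt q =P psrc r; last by rewrite (pcompN qr) pcompN // st.
have [t -> [t1 t2]] /= := pcompP qr.
have [u -> [u1 u2]] : exists2 u, pcomp s r = Some u &
    psrc u = psrc s /\ parrows u = parrows s ++ parrows r.
  by apply: pcompP; rewrite st.
have [v -> [v1 v2]] : exists2 v, pcomp p t = Some v &
    psrc v = psrc p /\ parrows v = parrows p ++ parrows t.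
  by apply: pcompP; rewrite t1.
by congr Some; apply: qpath_eq; rewrite ?u1 ?u2 ?v1 ?v2 ?s1 ?s2 ?t2 ?catA.
Qed.

Lemma pcomp_stationaryl x p :
  pcomp (stationary x) p = if x == psrc p then Some p else None.
Proof.
have [e|e] := x =P psrc p; last by rewrite pcompN.
have [r -> [r1 r2]] := @pcompP (stationary x) p e.
by congr Some; apply: qpath_eq; rewrite ?r1 ?r2.
Qed.

Lemma pcomp_stationaryr x p :
  pcomp p (stationary x) = if ptgt p == x then Some p else None.
Proof.
have [e|e] := ptgt p =P x; last by rewrite pcompN.
have [r -> [r1 r2]] := @pcompP p (stationary x) e.
by congr Some; apply: qpath_eq; rewrite ?r1 ?r2 ?cats0.
Qed.

Lemma pcomp_len p q r : pcomp p q = Some r -> plen r = (plen p + plen q)%N.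
Proof.
have [e|e] := ptgt p =P psrc q; last by rewrite pcompN.
by have [s -> [_ s2] [<-]] := pcompP e; rewrite /plen s2 size_cat.
Qed.

End Paths.

Section PathAlgebra.
Variables (K : fieldType) (Q : quiver).

Definition path_algebra := {malg K[qpath Q]}.
HB.instance Definition _ := GRing.Lmodule.on path_algebra.

Definition path_elt (p : qpath Q) : path_algebra := << p >>.

Definition opath_elt (o : option (qpath Q)) : path_algebra :=
  if o is Some r then path_elt r else 0.

Definition pa_mul (f g : path_algebra) : path_algebra :=
  mlift (fun p => mlift (fun q => opath_elt (pcomp p q)) g) f.

Definition pa_one : path_algebra := \sum_(x : vertex Q) path_elt (stationary x).

Lemma pa_mul_linl g : linear (pa_mul^~ g).
Proof. by move=> a f f'; rewrite /pa_mul linearP. Qed.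

Lemma pa_mul_linr f : linear (pa_mul f).
Proof.
move=> a g g'; rewrite /pa_mul -mlift_linl.
by apply: mlift_ext => p; rewrite linearP.
Qed.

HB.instance Definition _ f := GRing.isLinear.Build K path_algebra path_algebra _
  (pa_mul f) (pa_mul_linr f).

Definition pa_mulr g f := pa_mul f g.
HB.instance Definition _ g := GRing.isLinear.Build K path_algebra path_algebra _
  (pa_mulr g) (pa_mul_linl g).

Lemma pa_mulU p q : pa_mul (path_elt p) (path_elt q) = opath_elt (pcomp p q).
Proof. by rewrite /pa_mul !mliftU. Qed.

Lemma pa_ind (f g : {linear path_algebra -> path_algebra}) :
  (forall p, f (path_elt p) = g (path_elt p)) -> f =1 g.
Proof.
move=> fg x; rewrite (malg_linE f) (malg_linE g).
by apply: mlift_ext => p; apply: fg.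
Qed.

Lemma pa_mulA : associative pa_mul.
Proof.
move=> f g h.
rewrite -[LHS]/(pa_mulr (pa_mul g h) f) -[RHS]/((pa_mulr h \o pa_mulr g) f).
move: f; apply: pa_ind => p; rewrite /pa_mulr /=.
rewrite -[LHS]/((pa_mul (path_elt p) \o pa_mulr h) g).
rewrite -[RHS]/((pa_mulr h \o pa_mul (path_elt p)) g).
move: g; apply: pa_ind => q; rewrite /= /pa_mulr.
rewrite -[LHS]/((pa_mul (path_elt p) \o pa_mul (path_elt q)) h).
rewrite -[RHS]/(pa_mul (pa_mul (path_elt p) (path_elt q)) h).
move: h; apply: pa_ind => r; rewrite /= !pa_mulU.
have -> : pa_mul (path_elt p) (opath_elt (pcomp q r)) =
          opath_elt (obind (pcomp p) (pcomp q r)).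
  by case: (pcomp q r) => [s|] /=; rewrite ?pa_mulU // linear0.
rewrite -pcompA; case: (pcomp p q) => [s|] /=; rewrite ?pa_mulU //.
by rewrite -[RHS]/(pa_mulr _ 0) linear0.
Qed.

Lemma pa_mul1l : left_id pa_one pa_mul.
Proof.
move=> f; rewrite -[RHS]/(idfun f); move: f; apply: pa_ind => p /=.
rewrite -[LHS]/(pa_mulr (path_elt p) pa_one) linear_sum (bigD1 (psrc p)) //=.
rewrite /pa_mulr pa_mulU pcomp_stationaryl eqxx /= big1 ?addr0 // => x xp.
by rewrite pa_mulU pcomp_stationaryl (negbTE xp).
Qed.

Lemma pa_mul1r : right_id pa_one pa_mul.
Proof.
move=> f; rewrite -[RHS]/(idfun f) -[LHS]/(pa_mulr pa_one f).
move: f; apply: pa_ind => p; rewrite /= /pa_mulr.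
rewrite linear_sum (bigD1 (ptgt p)) //=.
rewrite pa_mulU pcomp_stationaryr eqxx /= big1 ?addr0 // => x xp.
by rewrite pa_mulU pcomp_stationaryr eq_sym (negbTE xp).
Qed.

Lemma pa_mulDl : left_distributive pa_mul +%R.
Proof. by move=> f g h; rewrite -[LHS]/(pa_mulr h _) linearD. Qed.

Lemma pa_mulDr : right_distributive pa_mul +%R.
Proof. by move=> f g h; rewrite linearD. Qed.

Lemma pa_one_coef x : pa_one@_(stationary x) = 1.
Proof.
rewrite raddf_sum /= (bigD1 x) //= mcoeffU eqxx big1 ?addr0 // => y yx.
rewrite mcoeffU; case: eqP => // -[exy]; case/eqP: yx.
exact: exy.
Qed.

Lemma pa_one_neq0 : pa_one != 0.
Proof.
have /card_gt0P [x _] := quiver_nonempty Q.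
apply/eqP => e; have := pa_one_coef x; rewrite e mcoeff0 => /eqP.
by rewrite eq_sym oner_eq0.
Qed.

HB.instance Definition _ := GRing.Zmodule_isNzRing.Build path_algebra
  pa_mulA pa_mul1l pa_mul1r pa_mulDl pa_mulDr pa_one_neq0.

Lemma pa_scaleAl (a : K) (f g : path_algebra) : a *: (f * g) = (a *: f) * g.
Proof. by rewrite -[RHS]/(pa_mulr g _) linearZ. Qed.

HB.instance Definition _ :=
  GRing.Lmodule_isLalgebra.Build K path_algebra pa_scaleAl.

Lemma pa_scaleAr (a : K) (f g : path_algebra) : a *: (f * g) = f * (a *: g).
Proof. by rewrite -[RHS]/(pa_mul f _) linearZ. Qed.

HB.instance Definition _ :=
  GRing.Lalgebra_isAlgebra.Build K path_algebra pa_scaleAr.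

Definition arrow_elt (a : arrow Q) : path_algebra := path_elt (arrow_path a).

End PathAlgebra.

Section GeneratedIdeal.
Variables (K : fieldType) (A : algType K).

Definition ideal_gen (S : set A) : {pred A} := fun x =>
  `[< forall W : {pred A}, ideal_closed W -> (forall s, S s -> s \in W) ->
      x \in W >].

Lemma ideal_gen_submod S : submod_closed (ideal_gen S).
Proof.
split=> [|a x y /asboolP xS /asboolP yS]; apply/asboolP => W cW SW.
  exact: cW.1.1.
by apply: cW.1.2; [apply: xS | apply: yS].
Qed.

Lemma ideal_gen_two_sided S a x :
  x \in ideal_gen S -> a * x \in ideal_gen S /\ x * a \in ideal_gen S.
Proof.
by move=> /asboolP xS; split; apply/asboolP => W cW SW;
  have [//] := cW.2 a x (xS W cW SW).
Qed.

Lemma ideal_gen_min S (W : {pred A}) : ideal_closed W ->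
  (forall s, S s -> s \in W) -> {subset ideal_gen S <= W}.
Proof. by move=> cW SW x /asboolP; apply. Qed.

End GeneratedIdeal.

Section TypeA.
Variable Q : quiver.

Definition three_cycle (a b c : arrow Q) : bool :=
  [&& tgt a == src b, tgt b == src c, tgt c == src a
    & uniq [:: src a; src b; src c]].

Definition three_cycles : {set {set arrow Q}} :=
  [set C | [exists a, exists b, exists c,
     three_cycle a b c && (C == [set a; b; c])]].

(* Arrows of the underlying graph with a direction of traversal: [(a, true)]
   goes along [a], [(a, false)] against it. *)
Definition dart := (arrow Q * bool)%type.
Definition dsrc (d : dart) : vertex Q := if d.2 then src d.1 else tgt d.1.
Definition dtgt (d : dart) : vertex Q := if d.2 then tgt d.1 else src d.1.

(* Non-trivial cycles of the underlying multigraph: no repeated edge and no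
   repeated vertex. Loops (length 1) and pairs of parallel or opposite arrows
   (length 2) are included. *)
Definition graph_cycle (c : seq dart) : bool :=
  [&& c != [::], cycle (fun d d' => dtgt d == dsrc d') c,
      uniq (map fst c) & uniq (map dsrc c)].

Definition adjacent (x y : vertex Q) : bool :=
  [exists a, ((src a == x) && (tgt a == y)) || ((src a == y) && (tgt a == x))].

Definition valency (v : vertex Q) : nat :=
  (#|[set a | @src Q a == v]| + #|[set a | @tgt Q a == v]|)%N.

Definition incident (v : vertex Q) : {set arrow Q} :=
  [set a | (src a == v) || (tgt a == v)].

(* Since [graph_cycle]s are 3-cycles, there are no loops, and [incident v] has
   [valency v] elements. *)
Definition mutation_class_A (k : nat) : Prop :=
  [/\ #|vertex Q| = k,
      forall x y, connect adjacent x y,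
      forall c, graph_cycle c -> [set a in map fst c] \in three_cycles
    & forall v, [/\ (valency v <= 4)%N,
        valency v = 4%N ->
          exists C C' : {set arrow Q}, [/\ C \in three_cycles,
            C' \in three_cycles, C != C',
            #|incident v :&: C| = 2%N & incident v :\: C \subset C']
      & valency v = 3%N ->
          exists C : {set arrow Q}, [/\ C \in three_cycles,
            #|incident v :&: C| = 2%N
          & forall a C', a \in incident v :\: C -> C' \in three_cycles ->
              a \notin C']]].

Variable K : fieldType.
Local Notation kQ := (path_algebra K Q).

Definition saturation_rels : set kQ := fun z =>
  exists a b c, three_cycle a b c /\ z = arrow_elt K a * arrow_elt K b.

Definition saturation_ideal : {pred kQ} := ideal_gen saturation_rels.

Definition long_elts : {pred kQ} := fun z =>
  [forall p : msupp z, (2 <= plen (val p))%N].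

Lemma long_eltsP z :
  reflect (forall p, z@_p != 0 -> (2 <= plen p)%N) (z \in long_elts).
Proof.
apply: (iffP forallP) => [H p | H p].
  by rewrite mcoeff_neq0 => pz; apply: (H [` pz]%fset).
by apply: H; rewrite mcoeff_neq0; apply: valP.
Qed.

Lemma long_elts_submod : submod_closed long_elts.
Proof.
split=> [|a x y /long_eltsP xL /long_eltsP yL]; apply/long_eltsP => p.
  by rewrite mcoeff0 eqxx.
rewrite mcoeffD mcoeffZ => nz; apply: contraT => sm.
have x0 : x@_p = 0 by apply/eqP; apply: contraNT sm => /xL.
have y0 : y@_p = 0 by apply/eqP; apply: contraNT sm => /yL.
by move: nz; rewrite {}x0 {}y0 mulr0 addr0 eqxx.
Qed.

HB.instance Definition _ :=
  GRing.isSubmodClosed.Build K kQ long_elts long_elts_submod.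

Lemma long_elts_path (p : qpath Q) : (2 <= plen p)%N -> path_elt K p \in long_elts.
Proof.
move=> lp; apply/long_eltsP => q; rewrite mcoeffU.
by case: (p =P q) => [<- //|_]; rewrite eqxx.
Qed.

Lemma long_elts_opath p q : (2 <= plen p + plen q)%N ->
  opath_elt K (pcomp p q) \in long_elts.
Proof.
move=> l; case E: (pcomp p q) => [r|] /=; last exact: rpred0.
by apply: long_elts_path; rewrite (pcomp_len E).
Qed.

Lemma long_elts_ideal : ideal_closed long_elts.
Proof.
split=> [|f z /long_eltsP zL]; first exact: long_elts_submod.
have msz p : p \in msupp z -> (2 <= plen p)%N by rewrite -mcoeff_neq0 => /zL.
split; rewrite /GRing.mul /= /pa_mul /mlift.
  apply: rpred_sum => p _; apply: rpredZ.
  rewrite big_seq; apply: rpred_sum => q qz; apply: rpredZ.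
  by apply: long_elts_opath; rewrite (leq_trans (msz _ qz)) ?leq_addl.
rewrite big_seq; apply: rpred_sum => p pz; apply: rpredZ.
apply: rpred_sum => q _; apply: rpredZ.
by apply: long_elts_opath; rewrite (leq_trans (msz _ pz)) ?leq_addr.
Qed.

Lemma saturation_ideal_proper : 1 \notin saturation_ideal.
Proof.
apply/negP => /(ideal_gen_min long_elts_ideal) H.
have /card_gt0P [x _] := quiver_nonempty Q.
have /long_eltsP /(_ (stationary x)) : 1 \in long_elts.
  apply: H => s [a [b [c [_ ->]]]].
  by rewrite /GRing.mul /= /arrow_elt pa_mulU long_elts_opath.
by rewrite (pa_one_coef K x) oner_neq0 => /(_ isT).
Qed.

HB.instance Definition _ :=
  GRing.isSubmodClosed.Build K kQ saturation_ideal (ideal_gen_submod _).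
HB.instance Definition _ := isProperTwoSided.Build K kQ saturation_ideal
  (@ideal_gen_two_sided K kQ _) saturation_ideal_proper.

(* k Q / I; this is a cluster-tilted algebra of type A_k exactly when
   [mutation_class_A k] holds. *)
Definition saturated_algebra := aquot saturation_ideal.
HB.instance Definition _ := GRing.Algebra.on saturated_algebra.

Definition special (v : vertex Q) : bool :=
  (valency v == 2%N) &&
  [exists a : arrow Q, exists b : arrow Q, [&& tgt a == v, src b == v
    & arrow_elt K a * arrow_elt K b \in saturation_ideal]].

Definition source_or_sink (v : vertex Q) : bool :=
  [forall a : arrow Q, tgt a != v] || [forall a : arrow Q, src a != v].

Definition nonzero_paths : set (qpath Q) :=
  [set p | (0 < plen p)%N /\ api saturation_ideal (path_elt K p) != 0].

Definition basis_end (v : vertex Q) : bool :=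
  special v || (valency v == 1%N) && source_or_sink v.

Definition basis_paths : set (qpath Q) :=
  [set p | [/\ nonzero_paths p, basis_end (psrc p) & basis_end (ptgt p)]]%classic.

(* [0] when the lengths in [P] have no maximum. *)
Definition longest (P : set (qpath Q)) : nat :=
  xget 0%N [set n | (exists2 p, P p & plen p = n) /\
                    forall p, P p -> (plen p <= n)%N]%classic.

Definition longest_to (b : vertex Q) : nat :=
  longest [set p | nonzero_paths p /\ ptgt p = b]%classic.

Definition longest_from (b : vertex Q) : nat :=
  longest [set p | nonzero_paths p /\ psrc p = b]%classic.

End TypeA.

Arguments nonzero_paths Q K : clear implicits.
Arguments basis_paths Q K : clear implicits.

(* Main.v *)
From HB Require Import structures.
Require Import Defs.
From mathcomp Require Import all_boot all_order all_algebra.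
From mathcomp Require Import finmap.
From mathcomp Require Import boolp classical_sets functions cardinality.
From mathcomp.multinomials Require Import monalg.
Require Import Defs.

(** An open Frobenius coproduct is determined by the tensor z = D(1), and the
    tensors that occur are those with az = za for all a.  Paths avoiding the
    relations form a basis of A; writing z in the induced basis p (x) q of the
    tensor square, the condition for each arrow a says that the coefficients of
    (ap) (x) q and p (x) (qa) agree, and that a coefficient vanishes when only one
    of the two shifts makes sense.  Since A is gentle, the pairs (p, q) linked by
    such shifts form chains, and the dimension is the number of chains on which
    nothing forces the coefficients to vanish.  These chains are of two kinds: all
    cuttings qp = P of a basis path P, and isolated pairs (p, q) of positive length
    meeting at a special vertex b, for which p and q can be chosen independently
    among the l(b ->) and l(-> b) paths starting and ending at b. *)

Set Implicit Arguments.
Unset Strict Implicit.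
Unset Printing Implicit Defensive.
Import GRing.Theory.

(** * 3-cycles and gentleness *)

(** Gentleness has two sources. By the cycle condition two 3-cycles cannot share an arrow, so an
    arrow has at most one relation on each side. By the valency conditions two of any three arrows
    at a vertex lie in one 3-cycle, so an arrow has at most one nonzero continuation on each side. A
    nonzero path never revisits a vertex: the closed part would be a 3-cycle and contain a relation.
    Hence everything is finite and chains end.

    Only two kinds of chain survive for the following reason. Move the last arrow a of q to the
    front of p. If this goes on until q is used up, the chain consists of the cuttings of one path
    P, and its coefficient vanishes if P extends at an end, or if its source has another outgoing
    arrow or its target another incoming one. If instead ap = 0, a further arrow at the junction
    would extend p or q to a nonzero path with no counterpart in the other factor, which kills the
    coefficient; without such an arrow the junction is a special vertex. *)

Section ThreeCycles.
Variable Q : quiver.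
Implicit Types (a b c : arrow Q) (C : {set arrow Q}) (x v : vertex Q).

(** The generating relations, stated on the quiver alone; by [arrows_in_saturation_ideal] no other
    product of two composable arrows vanishes. *)
Definition crel a b := [exists c, three_cycle a b c].

Lemma three_cycle_rot a b c : three_cycle a b c -> three_cycle b c a.
Proof.
case/and4P=> e1 e2 e3 u; apply/and4P; split=> //.
by rewrite -[[:: _; _; _]]/(rot 1 [:: src a; src b; src c]) rot_uniq.
Qed.

Lemma crelP a b : reflect (exists c, three_cycle a b c) (crel a b).
Proof. exact: existsP. Qed.

Lemma crel_comp a b : crel a b -> tgt a = src b.
Proof. by case/crelP=> c /and4P[/eqP]. Qed.

Lemma three_cyclesP C : reflect (exists a b c, three_cycle a b c /\ C = [set a; b; c])
  (C \in three_cycles Q).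
Proof.
rewrite inE; apply: (iffP existsP) => [[a /existsP[b /existsP[c /andP[abc /eqP->]]]]|].
  by exists a, b, c.
move=> [a [b [c [abc ->]]]]; exists a; apply/existsP; exists b; apply/existsP.
by exists c; rewrite abc eqxx.
Qed.

Lemma three_cycles_card C : C \in three_cycles Q -> #|C| = 3.
Proof.
case/three_cyclesP=> a [b [c [/and4P[_ _ _ u] ->]]].
have {}u : uniq [:: a; b; c] by apply: (@map_uniq _ _ (@src Q)).
rewrite -[3]/(size [:: a; b; c]) -(card_uniqP u).
by apply: eq_card => x; rewrite !inE orbA.
Qed.

Lemma three_cycles_mem C a : C \in three_cycles Q -> a \in C ->
  exists b c, three_cycle a b c /\ C = [set a; b; c].
Proof.
case/three_cyclesP=> x [y [z [xyz ->]]].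
rewrite !inE => /orP[/orP[]|] /eqP ->.
- by exists y, z.
- exists z, x; split; first exact: three_cycle_rot.
  by apply/setP=> w; rewrite !inE; case: (w == x); case: (w == y); case: (w == z).
- exists x, y; split; first by do 2!apply: three_cycle_rot.
  by apply/setP=> w; rewrite !inE; case: (w == x); case: (w == y); case: (w == z).
Qed.

Lemma three_cycles_crel C a b : C \in three_cycles Q -> a \in C -> b \in C ->
  tgt a = src b -> crel a b.
Proof.
move=> CC aC; have [b' [c [t ->]]] := three_cycles_mem CC aC.
have /and4P[/eqP e1 /eqP e2 /eqP e3 /=] := t.
rewrite !inE andbT => /andP[/norP[n1 n2] n3].
move=> /orP[/orP[]|] /eqP -> e; last 1 first.
- by rewrite -e e1 eqxx in n3.
- by rewrite -e e1 eqxx in n1.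
- by apply/crelP; exists c.
Qed.

Lemma three_cycles_src C a b : C \in three_cycles Q -> a \in C -> b \in C ->
  src a = src b -> a = b.
Proof.
move=> CC aC; have [b' [c [t ->]]] := three_cycles_mem CC aC.
have /and4P[/eqP e1 /eqP e2 /eqP e3 /=] := t.
rewrite !inE andbT => /andP[/norP[n1 n2] n3].
by move=> /orP[/orP[]|] /eqP -> // e; move: n1 n2; rewrite e eqxx.
Qed.

Lemma three_cycles_tgt C a b : C \in three_cycles Q -> a \in C -> b \in C ->
  tgt a = tgt b -> a = b.
Proof.
move=> CC aC; have [b' [c [t ->]]] := three_cycles_mem CC aC.
have /and4P[/eqP e1 /eqP e2 /eqP e3 /=] := t.
rewrite !inE andbT => /andP[/norP[n1 n2] n3].
move=> /orP[/orP[]|] /eqP -> // e; last by move: n1; rewrite -e1 e e3 eqxx.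
by move: n3; rewrite -e2 -e e1 eqxx.
Qed.

End ThreeCycles.

(** * Unique relations, unique nonzero continuations, and acyclicity of nonzero paths *)

Section Gentle.
Variables (Q : quiver) (k : nat).
Hypothesis hQ : mutation_class_A Q k.
Implicit Types (a b c : arrow Q) (x v : vertex Q) (l : seq (arrow Q)).

Lemma graph_cycle_size (d : seq (dart Q)) : graph_cycle d -> size d = 3.
Proof.
move=> gd; have [_ _ /(_ d gd) /three_cycles_card] := hQ; have [_ _ u _] := and4P gd.
by rewrite cardsE (card_uniqP u) size_map.
Qed.

Lemma no_loop a : src a <> tgt a.
Proof.
move=> e; suff /graph_cycle_size : graph_cycle [:: (a, true)] by [].
by rewrite /graph_cycle /dsrc /dtgt /= e eqxx.
Qed.

Lemma no_parallel a b : src a = src b -> tgt a = tgt b -> a = b.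
Proof.
move=> e1 e2; apply/eqP; apply: contraT => n.
suff /graph_cycle_size : graph_cycle [:: (a, true); (b, false)] by [].
rewrite /graph_cycle /dsrc /dtgt /= e1 e2 !eqxx /= !inE n /= andbT.
exact/eqP/no_loop.
Qed.

(** If the third vertices differ, b and c followed by c' and b' traversed backwards form a 4-cycle;
    if they agree, the arrows are parallel. *)
Lemma three_cycle_inj a b c b' c' :
  three_cycle a b c -> three_cycle a b' c' -> b = b' /\ c = c'.
Proof.
move=> /and4P[/eqP e1 /eqP e2 /eqP e3 u] /and4P[/eqP f1 /eqP f2 /eqP f3 u'].
have [e|n] := tgt b =P tgt b'.
  by split; apply: no_parallel; congruence.
move: u u'; rewrite /= !inE !andbT => /andP[/norP[n1 n2] n3] /andP[/norP[n1' n2'] n3'].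
suff /graph_cycle_size :
  graph_cycle [:: (b, true); (c, true); (c', false); (b', false)] by [].
have m : src c != src c' by apply/eqP; congruence.
have nbb' : b != b' by apply/eqP=> bb; apply: n; rewrite bb.
have sn (x y : arrow Q) : src x != src y -> (x == y) = false.
  by move=> nxy; apply: contraNF nxy => /eqP->.
have be : src b' = src b by rewrite -f1.
rewrite be in n1' n3'; rewrite eq_sym in n2; rewrite eq_sym in n1.
rewrite /graph_cycle /dsrc /dtgt /= e2 e3 f3 f2 be !eqxx /= !inE.
rewrite (sn b c) // (sn c c') // (sn b c') //.
rewrite [c == b']eq_sym (sn b' c) ?be // [c' == _]eq_sym (sn b' c') ?be //.
by rewrite (negbTE nbb') (negbTE n3) (negbTE n1) (negbTE n3') (negbTE n2) (negbTE m) n2'.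
Qed.

Lemma crel_injr a b b' : crel a b -> crel a b' -> b = b'.
Proof. by move=> /crelP[c t] /crelP[c' t']; case: (three_cycle_inj t t'). Qed.

Lemma crel_injl a a' b : crel a b -> crel a' b -> a = a'.
Proof.
move=> /crelP[c /three_cycle_rot t] /crelP[c' /three_cycle_rot t'].
by case: (three_cycle_inj t t').
Qed.

(** Pigeonhole: at valency three at most one incident arrow avoids the 3-cycle, and at valency four
    two 3-cycles cover all incident arrows. *)
Lemma incident_three_cycle v a b c : uniq [:: a; b; c] ->
  [&& a \in incident v, b \in incident v & c \in incident v] ->
  exists2 C, C \in three_cycles Q &
    [|| (a \in C) && (b \in C), (a \in C) && (c \in C) | (b \in C) && (c \in C)].
Proof.
move=> u /and3P[ai bi ci].
have sub : {subset [:: a; b; c] <= incident v}.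
  by apply/allP; rewrite /= ai bi ci.
have le3 : (3 <= #|incident v|)%N.
  have <- : #|[:: a; b; c]| = 3 by rewrite (card_uniqP u).
  exact/subset_leq_card/fintype.subsetP.
have lev : (#|incident v| <= valency v)%N.
  rewrite /valency -cardsUI; apply: leq_trans (leq_addr _ _).
  by apply/subset_leq_card/fintype.subsetP=> x; rewrite !inE.
have [_ _ _ /(_ v)[v4 H4 H3]] := hQ.
move: (leq_trans le3 lev); rewrite leq_eqVlt => /orP[/eqP/esym v3|v3].
  have [C [CC i2 _]] := H3 v3; exists C => //.
  have := cardsID C (incident v); rewrite i2 => D.
  have le1 : (#|incident v :\: C| <= 1)%N.
    by rewrite -(leq_add2l 2) D -[(2 + 1)%N]v3.
  have two (x y : arrow Q) : x != y -> x \in incident v -> y \in incident v ->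
      (x \in C) || (y \in C).
    move=> n xi yi; apply: contraLR le1 => /norP[xC yC]; rewrite -ltnNge.
    have <- : #|[set x; y]| = 2 by rewrite cards2 n.
    apply/subset_leq_card/fintype.subsetP=> z /set2P[]->.
      by rewrite finset.in_setD xC xi.
    by rewrite finset.in_setD yC yi.
  move: u; rewrite /= !inE !andbT => /andP[/norP[n1 n2] n3].
  move: (two _ _ n1 ai bi) (two _ _ n2 ai ci) (two _ _ n3 bi ci).
  by do 3!case: (_ \in C) => /=; move=> // _; do 3!case: (_ \in C') => /=.
have {}v4 : valency v = 4 by apply/eqP; rewrite eqn_leq v4 v3.
have [C [C' [CC CC' _ _ /fintype.subsetP s]]] := H4 v4.
have CoC (x : arrow Q) : x \in incident v -> (x \in C) || (x \in C').
  by move=> xi; case xC: (x \in C) => //=; apply: s; rewrite finset.in_setD xC xi.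
move: (CoC _ ai) (CoC _ bi) (CoC _ ci).
case: (boolP [|| (a \in C) && (b \in C), (a \in C) && (c \in C) | (b \in C) && (c \in C)]).
  by exists C.
move=> n1 aC bC cC; exists C' => //; move: n1 aC bC cC.
by do 3!case: (_ \in C) => /=; move=> // _; do 3!case: (_ \in C') => /=.
Qed.

Lemma no_loop_neq a b : tgt a = src b -> a != b.
Proof. by move=> e; apply/eqP=> ab; move: e; rewrite ab => /esym; apply: no_loop. Qed.

(** Two of a, b, b' lie in one 3-cycle. Either they are consecutive, which is a relation, or they
    share a source there and are equal. *)
Lemma crel_out a b b' : tgt a = src b -> tgt a = src b' ->
  ~~ crel a b -> ~~ crel a b' -> b = b'.
Proof.
move=> e e' n n'; apply/eqP; apply: contraT => bb'.
have u : uniq [:: a; b; b'].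
  by rewrite /= !inE negb_or bb' (no_loop_neq e) (no_loop_neq e').
have [|C CC] := @incident_three_cycle (tgt a) _ _ _ u.
  by rewrite !inE -e -e' !eqxx orbT.
case/or3P=> /andP[xC yC].
- by rewrite (three_cycles_crel CC xC yC) in n.
- by rewrite (three_cycles_crel CC xC yC) in n'.
- by rewrite (three_cycles_src CC xC yC) ?eqxx // -e in bb'.
Qed.

Lemma crel_in a a' b : tgt a = src b -> tgt a' = src b ->
  ~~ crel a b -> ~~ crel a' b -> a = a'.
Proof.
move=> e e' n n'; apply/eqP; apply: contraT => aa'.
have u : uniq [:: a; a'; b].
  by rewrite /= !inE negb_or aa' (no_loop_neq e) (no_loop_neq e').
have [|C CC] := @incident_three_cycle (src b) _ _ _ u.
  by rewrite !inE e e' !eqxx !orbT.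
case/or3P=> /andP[xC yC].
- by rewrite (three_cycles_tgt CC xC yC) ?eqxx // e in aa'.
- by rewrite (three_cycles_crel CC xC yC) in n.
- by rewrite (three_cycles_crel CC xC yC) in n'.
Qed.

Definition admissible l := sorted (fun a b => ~~ crel a b) l.

Lemma walk_src x l : walk x l -> map (@src Q) l = belast x (map (@tgt Q) l).
Proof. by elim: l x => //= a l IH x /andP[/eqP-> /IH ->]. Qed.

Lemma walk_path x a l :
  walk x (a :: l) = (src a == x) && path (fun a b => tgt a == src b) a l.
Proof.
rewrite /=; congr (_ && _).
by elim: l a => //= b l IH a; rewrite IH eq_sym.
Qed.

(** Distinct targets make the closed walk a [graph_cycle], hence three arrows long, and its first
    two arrows then form a relation. *)
Lemma closed_walk_not_admissible x a l : walk x (a :: l) ->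
  uniq (map (@tgt Q) (a :: l)) -> last x (map (@tgt Q) (a :: l)) = x ->
  ~~ admissible (a :: l).
Proof.
move=> w u e.
have us : uniq (map (@src Q) (a :: l)).
  rewrite (walk_src w); move: u e.
  rewrite !map_cons [uniq (_ :: _)](congr1 uniq (lastI _ _)) rcons_uniq /= => u0 e0.
  by rewrite -{1}e0.
have pw := w; rewrite walk_path in pw; have /andP[/eqP sa pl] := pw.
have gd : graph_cycle (map (fun b => (b, true)) (a :: l)).
  apply/and4P; split => //.
  - rewrite (@cycle_map _ _ (fun b => (b, true))) /= rcons_path.
    rewrite (@eq_path _ _ (fun a b => tgt a == src b)) // pl.
    by rewrite /dtgt /dsrc /= sa -(last_map (@tgt Q)); apply/eqP.
  - by rewrite -map_comp map_id (@map_uniq _ _ (@src Q)).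
  - by rewrite -map_comp.
have := graph_cycle_size gd; rewrite size_map.
move: l w u e us pw pl gd => [|b [|c []]] //= w u e us pw /and3P[ab bc _] _ _.
rewrite /admissible /=; suff -> : crel a b by [].
apply/crelP; exists c; apply/and4P; split=> //.
by rewrite e sa.
Qed.

Lemma admissible_uniq x l : walk x l -> admissible l -> uniq (x :: map (@tgt Q) l).
Proof.
elim: l x => //= a l IH x /andP[/eqP sa w] ad.
have ul := IH _ w (path_sorted ad); rewrite ul andbT.
apply/negP=> xin.
have /mapP[b bl xb] : x \in map (@tgt Q) (a :: l) by [].
move: ul w ad; rewrite -[_ && _]/(uniq (map (@tgt Q) (a :: l))).
have -> : walk (tgt a) l = walk x (a :: l) by rewrite /= sa eqxx.
rewrite -[path _ a l]/(admissible (a :: l)).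
(* Cut after the arrow that returns to x: the prefix is a closed walk whose targets are distinct by
   induction. *)
case/path.splitP: bl => p1 p2; rewrite map_cat cat_uniq walk_cat => /andP[u _] /andP[w _].
move=> /cat_sorted2[ad _]; move: u w ad.
have {xb}: last x (map (@tgt Q) (rcons p1 b)) = x by rewrite map_rcons last_rcons.
case: p1 => [|c p1] /= e u w ad.
  by have := @closed_walk_not_admissible x b [::] w u e.
by have := @closed_walk_not_admissible x c (rcons p1 b) w u e; rewrite /admissible /= ad.
Qed.

Lemma admissible_size x l : walk x l -> admissible l -> (size l < #|vertex Q|)%N.
Proof.
move=> w /(admissible_uniq w)/card_uniqP; rewrite /= size_map => <-.
exact: max_card.
Qed.

End Gentle.

(** * Dimension *)

Section Dimension.
Local Open Scope ring_scope.
Variables (K : fieldType) (V : lmodType K).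
Implicit Types W : set V.

Lemma has_dim_leq W m n : has_dim W m -> has_dim W n -> (m <= n)%N.
Proof.
move=> [e [We fe]] [f [Wf _]].
have : forall i, exists c : 'I_n -> K, e i = \sum_j c j *: f j.
  move=> i; have : W (e i).
    rewrite We /=; exists (fun j => (j == i)%:R).
    rewrite (bigD1 i) //= eqxx scale1r big1 ?addr0 // => j /negbTE ->.
    by rewrite scale0r.
  by rewrite Wf.
move=> /choice[c ec].
have : forall j, exists d : 'I_m -> K, f j = \sum_i d i *: e i.
  move=> j; have : W (f j).
    rewrite Wf /=; exists (fun i => (i == j)%:R).
    rewrite (bigD1 j) //= eqxx scale1r big1 ?addr0 // => i /negbTE ->.
    by rewrite scale0r.
  by rewrite We.
move=> /choice[d fd].
(* The two coordinate changes multiply to the identity of size m, which bounds m by the inner size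
   n. *)
apply: (@mulmx1_min _ _ _ (\matrix_(i, j) c i j) (\matrix_(j, i) d j i)).
apply/matrixP => i i'; rewrite !mxE; apply/eqP; rewrite -subr_eq0; apply/eqP.
pose g i' := \sum_j (\matrix_(i, j) c i j) i j * (\matrix_(j, i) d j i) j i' - (i == i')%:R.
rewrite -[LHS]/(g i'); apply: fe => {i'}.
transitivity (e i - e i); last by rewrite subrr.
rewrite /g; under eq_bigr do rewrite scalerBl; rewrite sumrB; congr (_ - _).
  rewrite [RHS]ec; under eq_bigr do rewrite scaler_suml.
  rewrite exchange_big /=; apply: eq_bigr => j _; rewrite fd scaler_sumr.
  by apply: eq_bigr => i' _; rewrite !mxE scalerA.
rewrite (bigD1 i) //= eqxx scale1r big1 ?addr0 // => j /negbTE ij.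
by rewrite eq_sym ij scale0r.
Qed.

Lemma dimE W n : has_dim W n -> dim W = n.
Proof.
move=> Wn; apply: xget_unique => // m Wm.
by apply/eqP; rewrite eqn_leq !(has_dim_leq Wm Wn, has_dim_leq Wn Wm).
Qed.

(** Evaluating the functionals gives independence. Every w minus its candidate expansion is killed
    by all of them, so separation gives spanning. *)
Lemma has_dim_dual W (T : finType) (e : T -> V) (phi : T -> {linear V -> K^o}) :
  W 0 -> (forall a x y, W x -> W y -> W (a *: x + y)) ->
  (forall t, W (e t)) -> (forall s t, phi s (e t) = (s == t)%:R) ->
  (forall w, W w -> (forall t, phi t w = 0) -> w = 0) -> has_dim W #|T|.
Proof.
move=> W0 Wlin We dual sep.
have Wsum (c : 'I_#|T| -> K) : W (\sum_i c i *: e (enum_val i)).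
  apply: (@big_ind _ W) => // [x y Wx Wy|i _]; first by rewrite -[x]scale1r; apply: Wlin.
  by rewrite -[_ *: _]addr0; apply: Wlin.
have phi_sum (c : 'I_#|T| -> K) j : phi (enum_val j) (\sum_i c i *: e (enum_val i)) = c j.
  rewrite linear_sum (bigD1 j) //= linearZ /= dual eqxx big1 ?addr0 ?mulr1 // => [|i ij].
    exact: mulr1.
  rewrite linearZ /= dual (inj_eq enum_val_inj) eq_sym (negbTE ij).
  exact: mulr0.
exists (fun i => e (enum_val i)); split=> [|c c0 i]; last first.
  by rewrite -(phi_sum c) c0 linear0.
apply/seteqP; split=> [w Ww|w [c ->] //]; exists (fun i => phi (enum_val i) w).
apply/eqP; rewrite -subr_eq0; apply/eqP; apply: sep => [|t].
  by rewrite addrC -scaleN1r; apply: Wlin.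
by rewrite linearB /= -[t](enum_rankK t) phi_sum subrr.
Qed.

End Dimension.

(** * Paths and the basis of the algebra *)

Section Good.
Variable Q : quiver.
Implicit Types (p q r : qpath Q) (b : arrow Q).

Definition good p := admissible (parrows p).

Lemma parrows_comp p q r : pcomp p q = Some r -> parrows r = parrows p ++ parrows q.
Proof.
have [e|e] := ptgt p =P psrc q; last by rewrite pcompN.
by have [s -> [_ s2] [<-]] := pcompP e.
Qed.

Lemma psrc_comp p q r : pcomp p q = Some r -> psrc r = psrc p.
Proof.
have [e|e] := ptgt p =P psrc q; last by rewrite pcompN.
by have [s -> [s1 _] [<-]] := pcompP e.
Qed.

Lemma comp_junction p q r : pcomp p q = Some r -> ptgt p = psrc q.
Proof. by have [//|e] := ptgt p =P psrc q; rewrite pcompN. Qed.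

Lemma ptgt_pcomp p q r : pcomp p q = Some r -> ptgt r = ptgt q.
Proof. by move=> e; apply: (ptgt_comp (psrc_comp e) (parrows_comp e) (comp_junction e)). Qed.

Lemma good_comp p q r : pcomp p q = Some r -> good r -> good p /\ good q.
Proof.
by move=> /parrows_comp e; rewrite /good /admissible e => /cat_sorted2[].
Qed.

Lemma pcomp_injr p q q' r : pcomp p q = Some r -> pcomp p q' = Some r -> q = q'.
Proof.
move=> e e'; apply: qpath_eq; first by rewrite -(comp_junction e) (comp_junction e').
have /eqP := parrows_comp e; rewrite (parrows_comp e') eqseq_cat //.
by move=> /andP[_ /eqP].
Qed.

Lemma pcomp_injl p p' q r : pcomp p q = Some r -> pcomp p' q = Some r -> p = p'.
Proof.
move=> e e'; apply: qpath_eq; first by rewrite -(psrc_comp e) (psrc_comp e').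
have /eqP := parrows_comp e; rewrite (parrows_comp e') eqseq_cat.
  by move=> /andP[/eqP].
by apply: (@addIn (plen q)); rewrite -(pcomp_len e) -(pcomp_len e').
Qed.

Lemma qpath_ind (P : qpath Q -> Prop) :
  (forall x, P (stationary x)) ->
  (forall b p r, pcomp (arrow_path b) p = Some r -> P p -> P r) -> forall p, P p.
Proof.
move=> Ps Pc [[x l] /= w]; elim: l x w => [|b l IH] x w.
  by by have -> : QPath (qpath_val := (x, [::])) w = stationary x by apply: qpath_eq.
have /andP[/eqP sb wl] := w.
pose p := QPath (qpath_val := (tgt b, l)) wl.
have [|r e [r1 r2]] := @pcompP _ (arrow_path b) p; first by [].
by apply: (Pc b p) (IH _ wl); rewrite e; congr Some; apply: qpath_eq; rewrite ?r1 ?r2.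
Qed.

End Good.

Section SaturatedAlgebra.
Local Open Scope ring_scope.
Variables (K : fieldType) (Q : quiver).
Local Notation kQ := (path_algebra K Q).
Local Notation I := (@saturation_ideal Q K).
Local Notation A := (saturated_algebra Q K).
Implicit Types (p q r : qpath Q) (b : arrow Q) (f g : kQ) (u v : A).

Lemma path_eltM p q : path_elt K p * path_elt K q = opath_elt K (pcomp p q).
Proof. exact: pa_mulU. Qed.

Lemma mcoeffM f g r : (f * g : kQ)@_r =
  \sum_(p <- msupp f) \sum_(q <- msupp g) f@_p * (g@_q * (pcomp p q == Some r)%:R).
Proof.
rewrite /GRing.mul /= /pa_mul /mlift raddf_sum; apply: eq_bigr => p _ /=.
rewrite mcoeffZ raddf_sum mulr_sumr; apply: eq_bigr => q _ /=.
rewrite mcoeffZ; congr (_ * (_ * _)); case: (pcomp p q) => [s|] /=.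
  by rewrite mcoeffU.
by rewrite mcoeff0.
Qed.

Lemma sum_coef_pred (g : kQ) (P : qpath Q -> bool) r : (forall q, P q = (q == r)) ->
  \sum_(q <- msupp g) g@_q * (P q)%:R = g@_r.
Proof.
move=> e; rewrite {3}[g]monalgE raddf_sum; apply: eq_bigr => q _ /=.
by rewrite mcoeffU e mulr_natr.
Qed.

Lemma mcoeff_mull p g q r : pcomp p q = Some r -> (path_elt K p * g : kQ)@_r = g@_q.
Proof.
move=> e; rewrite mcoeffM msuppU oner_eq0 big_seq_fset1 mcoeffUU.
under eq_bigr do rewrite mul1r; apply: sum_coef_pred => q'.
by apply/eqP/eqP => [e'|-> //]; apply: pcomp_injr e' e.
Qed.

Lemma mcoeff_mull0 p g r : (forall q, pcomp p q <> Some r) -> (path_elt K p * g : kQ)@_r = 0.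
Proof.
move=> e; rewrite mcoeffM msuppU oner_eq0 big_seq_fset1 big1 // => q _.
by have /eqP/negbTE -> := e q; rewrite !mulr0.
Qed.

Lemma mcoeff_mulr q g p r : pcomp p q = Some r -> (g * path_elt K q : kQ)@_r = g@_p.
Proof.
move=> e; rewrite mcoeffM msuppU oner_eq0.
under eq_bigr do rewrite big_seq_fset1 mcoeffUU mul1r; apply: sum_coef_pred => p'.
by apply/eqP/eqP => [e'|-> //]; apply: pcomp_injl e' e.
Qed.

Lemma mcoeff_mulr0 q g r : (forall p, pcomp p q <> Some r) -> (g * path_elt K q : kQ)@_r = 0.
Proof.
move=> e; rewrite mcoeffM big1 // => p _.
rewrite msuppU oner_eq0 big_seq_fset1.
by have /eqP/negbTE -> := e p; rewrite !mulr0.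
Qed.

(** The span of the paths containing a relation. Factors of good paths are good, so this is an
    ideal, and minimality of I places I inside it. *)
Definition bad_elts : {pred kQ} := fun z => `[< forall p, good p -> z@_p = 0 >].

Lemma bad_elts_ideal : ideal_closed bad_elts.
Proof.
split=> [|f z /asboolP zB].
  split=> [|a x y /asboolP xB /asboolP yB]; apply/asboolP => p gp.
    by rewrite mcoeff0.
  by rewrite mcoeffD mcoeffZ xB // yB // mulr0 addr0.
split; apply/asboolP => r gr; rewrite mcoeffM big1 // => p _; rewrite big1 // => q _;
  have [e|] := pcomp p q =P Some r; rewrite ?mulr0 //;
  have [gp gq] := good_comp e gr.
  by rewrite zB // mul0r mulr0.
by rewrite zB // mul0r.
Qed.

Lemma saturation_ideal_coef z p : z \in I -> good p -> z@_p = 0.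
Proof.
move=> zI gp; have /asboolP/(_ p gp) // : z \in bad_elts.
apply: (ideal_gen_min bad_elts_ideal) zI => s [a [b [c [t ->]]]].
apply/asboolP => q gq; rewrite /arrow_elt path_eltM.
case e: (pcomp _ _) => [r|] /=; last by rewrite mcoeff0.
rewrite mcoeffU; case: eqP => [rq|] //; move: gq.
rewrite -rq /good (parrows_comp e) /admissible /= andbT => /negP[].
by apply/crelP; exists c.
Qed.

(** Peel arrows off the front until the rest is good; the relation then sits at the first junction,
    where the two arrows multiply to a generator. *)
Lemma not_good_in_saturation_ideal p : ~~ good p -> path_elt K p \in I.
Proof.
elim/qpath_ind: p => [x|b p r e IH ngr]; first by [].
have eE : path_elt K r = arrow_elt K b * path_elt K p.
  by rewrite /arrow_elt path_eltM e.
have [gp|ngp] := boolP (good p); last first.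
  by rewrite eE; apply: (ideal_gen_two_sided (arrow_elt K b) (IH ngp)).1.
elim/qpath_ind: p {IH} e eE gp => [x|c p p' e _] e' -> gp.
  by move: ngr; rewrite /good (parrows_comp e').
have -> : path_elt K p' = arrow_elt K c * path_elt K p.
  by rewrite /arrow_elt path_eltM e.
rewrite mulrA; apply: (ideal_gen_two_sided _ _).2; apply/asboolP => W _; apply.
suff /crelP[d bc] : crel b c by exists b, c, d.
move: ngr gp; rewrite /good /admissible (parrows_comp e') (parrows_comp e) /=.
by case: crel => //= /negP.
Qed.

Lemma saturation_idealP z : reflect (forall p, good p -> z@_p = 0) (z \in I).
Proof.
apply: (iffP idP) => [zI p|z0]; first exact: saturation_ideal_coef.
rewrite [z]monalgE; apply: rpred_sum => p _; rewrite -malg_scaleU.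
have [/z0 ->|ngp] := boolP (good p); first by rewrite scale0r rpred0.
exact/rpredZ/not_good_in_saturation_ideal.
Qed.

Lemma path_in_saturation_ideal p : (path_elt K p \in I) = ~~ good p.
Proof.
apply/idP/idP => [/saturation_idealP H|]; last exact: not_good_in_saturation_ideal.
by apply/negP => /H/eqP; rewrite mcoeffUU oner_eq0.
Qed.

Lemma arrows_in_saturation_ideal a b : tgt a = src b ->
  (arrow_elt K a * arrow_elt K b \in I) = crel a b.
Proof.
move=> e; have [r er] := @pcompP _ (arrow_path a) (arrow_path b) e; move=> _.
have -> : arrow_elt K a * arrow_elt K b = path_elt K r.
  by rewrite /arrow_elt path_eltM er.
by rewrite path_in_saturation_ideal /good (parrows_comp er) /admissible /= andbT negbK.
Qed.

Lemma nonzero_pathsE p : nonzero_paths Q K p <-> (0 < plen p)%N /\ good p.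
Proof. by rewrite /nonzero_paths /= api_eq0 path_in_saturation_ideal negbK. Qed.

Definition pathA p : A := api (@saturation_ideal Q K) (path_elt K p).

Lemma pathA_eq0 p : ~~ good p -> pathA p = 0.
Proof. by move=> ngp; apply/eqP; rewrite api_eq0 path_in_saturation_ideal. Qed.

Lemma pathAM p q : pathA p * pathA q = if pcomp p q is Some r then pathA r else 0.
Proof.
rewrite /pathA -rmorphM /=.
rewrite path_eltM; case: (pcomp p q) => //=.
exact: rmorph0.
Qed.

(** Reading the chosen representative is linear because elements of I have zero coefficients on good
    paths; the default 0 extends linearity to every p. *)
Definition pcoef p u : K^o :=
  if good p then (repr (u : lquot (@saturation_ideal Q K)))@_p else 0.

Lemma pcoef_api p f : pcoef p (api (@saturation_ideal Q K) f) = if good p then f@_p else 0.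
Proof.
rewrite /pcoef; case: ifP => // gp; apply/eqP; rewrite -subr_eq0 -mcoeffB; apply/eqP.
by apply: saturation_ideal_coef gp; apply: repr_lpi.
Qed.

Lemma pcoef_is_linear p : linear (pcoef p).
Proof.
move=> a u v; have [[x ->] [y ->]] := (api_surj u, api_surj v).
rewrite -linearP !pcoef_api; case: ifP => _; last by rewrite scaler0 addr0.
by rewrite mcoeffD mcoeffZ.
Qed.
HB.instance Definition _ p :=
  GRing.isLinear.Build K A K^o _ (pcoef p) (pcoef_is_linear p).

Lemma pcoef_path p q : good p -> pcoef p (pathA q) = (q == p)%:R.
Proof. by move=> gp; rewrite pcoef_api gp mcoeffU. Qed.

Lemma pcoef_mull p q r u : good r -> pcomp p q = Some r ->
  pcoef r (pathA p * u) = pcoef q u.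
Proof.
move=> gr e; have [x ->] := api_surj u; have [_ gq] := good_comp e gr.
by rewrite /pathA -rmorphM !pcoef_api gr gq (mcoeff_mull _ e).
Qed.

Lemma pcoef_mull0 p r u : (forall q, pcomp p q <> Some r) -> pcoef r (pathA p * u) = 0.
Proof.
move=> e; have [x ->] := api_surj u.
by rewrite /pathA -rmorphM !pcoef_api mcoeff_mull0 // if_same.
Qed.

Lemma pcoef_mulr p q r u : good r -> pcomp p q = Some r ->
  pcoef r (u * pathA q) = pcoef p u.
Proof.
move=> gr e; have [x ->] := api_surj u; have [gp _] := good_comp e gr.
by rewrite /pathA -rmorphM !pcoef_api gr gp (mcoeff_mulr _ e).
Qed.

Lemma pcoef_mulr0 q r u : (forall p, pcomp p q <> Some r) -> pcoef r (u * pathA q) = 0.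
Proof.
move=> e; have [x ->] := api_surj u.
by rewrite /pathA -rmorphM !pcoef_api mcoeff_mulr0 // if_same.
Qed.

Section Basis.
Variable N : {fset qpath Q}.
Hypothesis NP : forall p, (p \in N) = good p.

Lemma pcoefE u : u = \sum_(p <- N) (pcoef p u : K) *: pathA p.
Proof.
have [f ->] := api_surj u.
pose M := (msupp f `|` N)%fset.
transitivity (\sum_(p <- M) f@_p *: pathA p).
  have {1}-> : f = \sum_(p <- M) f@_p *: path_elt K p.
    by rewrite -[LHS]/(idfun f) malg_linE (mliftEw _ (fsubsetUl _ N)).
  by rewrite linear_sum; apply: eq_bigr => p _; rewrite linearZ.
rewrite -(big_fset_incl _ (fsubsetUr (msupp f) N)) => [|p _ /=]; last first.
  by rewrite NP => /pathA_eq0 ->; rewrite scaler0.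
by apply: eq_big_seq => p; rewrite NP => gp; rewrite pcoef_api gp.
Qed.

End Basis.

End SaturatedAlgebra.

(** * Actions on the tensor square *)

Section TensorLinear.
Local Open Scope ring_scope.
Variables (K : fieldType) (U V : lmodType K).
Implicit Types (u : U) (v : V).

HB.instance Definition _ u :=
  GRing.isLinear.Build K V (tensor U V) _ (tens u) (tens_linr u).

Definition tensl v u : tensor U V := tens u v.
HB.instance Definition _ v :=
  GRing.isLinear.Build K U (tensor U V) _ (tensl v) (@tens_linl K U V v).

Lemma tens_ind (P : tensor U V -> Prop) : P 0 ->
  (forall x y, P x -> P y -> P (x + y)) -> (forall u v, P (tens u v)) -> forall z, P z.
Proof.
move=> P0 PD Pt z; rewrite -[z]lpi_repr; set g := repr _.
rewrite [g]monalgE linear_sum; apply: (@big_ind _ P) => // -[u v] _.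
rewrite -malg_scaleU linearZ /= -[lpi _ _]/(tensl v u) -linearZ; exact: Pt.
Qed.

End TensorLinear.

Section OuterActions.
Local Open Scope ring_scope.
Variables (K : fieldType) (A : algType K).
Implicit Types (a b : A) (z : tensor A A).

Lemma bilinear_lact a : bilinear_map (fun x y : A => tens (a * x) y).
Proof.
split=> [v|u] c x y; last exact: tens_linr.
by rewrite mulrDr -scalerAr; apply: tens_linl.
Qed.

Lemma bilinear_ract b : bilinear_map (fun x y : A => tens x (y * b)).
Proof.
split=> [v|u] c x y; first exact: tens_linl.
by rewrite mulrDl -scalerAl; apply: tens_linr.
Qed.

HB.instance Definition _ a := GRing.isLinear.Build K (tensor A A) (tensor A A) _
  (tens_lact a) (tlift_is_linear (bilinear_lact a)).
HB.instance Definition _ b := GRing.isLinear.Build K (tensor A A) (tensor A A) _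
  (tens_ract b) (tlift_is_linear (bilinear_ract b)).

Local Opaque tens tens_lact tens_ract.

Lemma tens_lact_linr a : linear (tens_lact a).
Proof. exact: tlift_is_linear (bilinear_lact a). Qed.
Lemma tens_ract_linr a : linear (tens_ract a).
Proof. exact: tlift_is_linear (bilinear_ract a). Qed.

Lemma tens_lact0 a : tens_lact a 0 = 0. Proof. exact: linear0. Qed.
Lemma tens_lactD a : {morph tens_lact a : x y / x + y}. Proof. exact: linearD. Qed.
Lemma tens_ract0 a : tens_ract a 0 = 0. Proof. exact: linear0. Qed.
Lemma tens_ractD a : {morph tens_ract a : x y / x + y}. Proof. exact: linearD. Qed.

Lemma tens_lact_lin z : linear (fun a : A => tens_lact a z).
Proof.
elim/tens_ind: z => [|x y IHx IHy|u v] c a b /=.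
- by rewrite !tens_lact0 scaler0 addr0.
- by rewrite !tens_lactD IHx IHy scalerDr addrACA.
- by rewrite !tens_lactE mulrDl -scalerAl; apply: tens_linl.
Qed.

Lemma tens_ract_lin z : linear (fun a : A => tens_ract a z).
Proof.
elim/tens_ind: z => [|x y IHx IHy|u v] c a b /=.
- by rewrite !tens_ract0 scaler0 addr0.
- by rewrite !tens_ractD IHx IHy scalerDr addrACA.
- by rewrite !tens_ractE mulrDr -scalerAr; apply: tens_linr.
Qed.

Lemma tens_lactM a b z : tens_lact (a * b) z = tens_lact a (tens_lact b z).
Proof.
elim/tens_ind: z => [|x y IHx IHy|u v]; first by rewrite !tens_lact0.
  by rewrite !tens_lactD IHx IHy.
by rewrite !tens_lactE mulrA.
Qed.

Lemma tens_ractM a b z : tens_ract (a * b) z = tens_ract b (tens_ract a z).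
Proof.
elim/tens_ind: z => [|x y IHx IHy|u v]; first by rewrite !tens_ract0.
  by rewrite !tens_ractD IHx IHy.
by rewrite !tens_ractE mulrA.
Qed.

Lemma tens_lract a b z : tens_lact a (tens_ract b z) = tens_ract b (tens_lact a z).
Proof.
elim/tens_ind: z => [|x y IHx IHy|u v]; first by rewrite tens_ract0 tens_lact0 tens_ract0.
  apply: etrans (congr1 (tens_lact a) (tens_ractD b x y)) _.
  apply: etrans (tens_lactD a (tens_ract b x) (tens_ract b y)) _.
  apply: etrans (congr2 +%R IHx IHy) _.
  apply: esym.
  apply: etrans (congr1 (tens_ract b) (tens_lactD a x y)) _.
  exact: (tens_ractD b (tens_lact a x) (tens_lact a y)).
by rewrite tens_lactE !tens_ractE tens_lactE.
Qed.

Lemma tens_lact1 z : tens_lact 1 z = z.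
Proof.
elim/tens_ind: z => [|x y IHx IHy|u v]; first by rewrite tens_lact0.
  by rewrite tens_lactD IHx IHy.
by rewrite tens_lactE mul1r.
Qed.

Definition tens_central z := forall a, tens_lact a z = tens_ract a z.

Lemma open_frobenius_unit (D : A -> tensor A A) : open_frobenius D ->
  tens_central (D 1) /\ forall a, D a = tens_lact a (D 1).
Proof.
move=> [_ Dl Dr]; split=> a; last by rewrite -Dl mulr1.
by rewrite -Dl -Dr mulr1 mul1r.
Qed.

(** Right linearity is (ab)z = a(bz) = a(zb) = (az)b, since the two outer actions commute. *)
Lemma open_frobenius_lact z : tens_central z -> open_frobenius (fun a : A => tens_lact a z).
Proof.
move=> cz; split=> [|a b|a b]; first exact: tens_lact_lin.
  exact: tens_lactM.
rewrite (tens_lactM a b z) (cz b); exact: tens_lract.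
Qed.

End OuterActions.

(** * Coefficient functionals on the tensor square and central tensors *)

Section TensorFunctionals.
Local Open Scope ring_scope.
Local Opaque tens tens_lact tens_ract.
Variables (K : fieldType) (A : algType K).
Implicit Types (phi psi : {linear A -> K^o}) (a u v : A) (z : tensor A A).

Lemma bilinear_tfun phi psi : bilinear_map (fun u v : A => (phi u * psi v : K^o)).
Proof.
split=> [v|u] c x y; first by rewrite linearP mulrDl -mulrA.
by rewrite linearP mulrDr mulrCA.
Qed.

(** The functional phi (x) psi; for dual bases it reads one coefficient of a tensor. *)
Definition tfun phi psi z : K^o := tlift (fun u v : A => (phi u * psi v : K^o)) z.
HB.instance Definition _ phi psi := GRing.isLinear.Build K (tensor A A) K^o _
  (tfun phi psi) (tlift_is_linear (bilinear_tfun phi psi)).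

Lemma tfun_tens phi psi u v : tfun phi psi (tens u v) = phi u * psi v.
Proof. exact: (tliftE u v (bilinear_tfun phi psi)). Qed.

Local Opaque tfun.

Lemma tfun0 phi psi : tfun phi psi 0 = 0. Proof. exact: linear0. Qed.
Lemma tfunD phi psi : {morph tfun phi psi : x y / x + y}. Proof. exact: linearD. Qed.
Lemma tfunZ phi psi (c : K) z : tfun phi psi (c *: z) = c * tfun phi psi z.
Proof. exact: linearZ. Qed.

Lemma tfun_lact a phi phi' psi z : (forall u, phi (a * u) = phi' u) ->
  tfun phi psi (tens_lact a z) = tfun phi' psi z.
Proof.
move=> e; apply: (@tens_ext _ _ _ _ (tfun phi psi \o tens_lact a) (tfun phi' psi)).
by move=> u v /=; rewrite (tens_lactE a u v) !tfun_tens e.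
Qed.

Lemma tfun_lact0 a phi psi z : (forall u, phi (a * u) = 0) ->
  tfun phi psi (tens_lact a z) = 0.
Proof.
move=> e; apply: (@tens_ext _ _ _ _ (tfun phi psi \o tens_lact a) \0).
by move=> u v /=; rewrite (tens_lactE a u v) tfun_tens e mul0r.
Qed.

Lemma tfun_ract a phi psi psi' z : (forall u, psi (u * a) = psi' u) ->
  tfun phi psi (tens_ract a z) = tfun phi psi' z.
Proof.
move=> e; apply: (@tens_ext _ _ _ _ (tfun phi psi \o tens_ract a) (tfun phi psi')).
by move=> u v /=; rewrite (tens_ractE a u v) !tfun_tens e.
Qed.

Lemma tfun_ract0 a phi psi z : (forall u, psi (u * a) = 0) ->
  tfun phi psi (tens_ract a z) = 0.
Proof.
move=> e; apply: (@tens_ext _ _ _ _ (tfun phi psi \o tens_ract a) \0).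
by move=> u v /=; rewrite (tens_ractE a u v) tfun_tens e mulr0.
Qed.

(** With [tens_central_mul]: the a with az = za are closed under linear combinations and products,
    so centrality can be checked on generators. *)
Lemma tens_central_lin z c a b : tens_lact a z = tens_ract a z ->
  tens_lact b z = tens_ract b z ->
  tens_lact (c *: a + b) z = tens_ract (c *: a + b) z.
Proof.
move=> ea eb; apply: etrans (tens_lact_lin z c a b) _.
apply: etrans (congr2 (fun s t => c *: s + t) ea eb) _.
exact/esym/(tens_ract_lin z c a b).
Qed.

Lemma tens_central_mul z a b : tens_lact a z = tens_ract a z ->
  tens_lact b z = tens_ract b z -> tens_lact (a * b) z = tens_ract (a * b) z.
Proof.
move=> ea eb; apply: etrans (tens_lactM a b z) _.
apply: etrans (congr1 (tens_lact a) eb) _.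
apply: etrans (tens_lract a b z) _.
apply: etrans (congr1 (tens_ract b) ea) _.
exact/esym/(tens_ractM a b z).
Qed.

Definition tens_lactl z a := tens_lact a z.
HB.instance Definition _ z :=
  GRing.isLinear.Build K A (tensor A A) _ (tens_lactl z) (tens_lact_lin z).
Definition tens_ractl z a := tens_ract a z.
HB.instance Definition _ z :=
  GRing.isLinear.Build K A (tensor A A) _ (tens_ractl z) (tens_ract_lin z).

Lemma tens_central_sum z (I : Type) (s : seq I) (c : I -> K) (e : I -> A) :
  (forall i, tens_lact (e i) z = tens_ract (e i) z) ->
  tens_lact (\sum_(i <- s) c i *: e i) z = tens_ract (\sum_(i <- s) c i *: e i) z.
Proof.
move=> ez; elim: s => [|i s IH].
  by rewrite big_nil; apply: etrans (linear0 (tens_lactl z)) (esym (linear0 (tens_ractl z))).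
rewrite big_cons; exact: (tens_central_lin (c i) (ez i) IH).
Qed.

Section DualBasis.
Variables (I : choiceType) (s : seq I) (e : I -> A) (phi : I -> {linear A -> K^o}).
Hypothesis expand : forall u, u = \sum_(i <- s) (phi i u : K) *: e i.

Lemma tens_expand z :
  z = \sum_(i <- s) \sum_(j <- s) (tfun (phi i) (phi j) z : K) *: tens (e i) (e j).
Proof.
elim/tens_ind: z => [|x y IHx IHy|u v].
- rewrite big1 // => i _; rewrite big1 // => j _.
  by rewrite (tfun0 (phi i) (phi j)) scale0r.
- rewrite {1}IHx {1}IHy -big_split; apply: eq_bigr => i _.
  rewrite -big_split; apply: eq_bigr => j _ /=.
  by rewrite (tfunD (phi i) (phi j) x y) scalerDl.
- rewrite {1}[u]expand -[LHS]/(tensl v _) linear_sum; apply: eq_bigr => i _.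
  rewrite linearZ /= /tensl {1}[v]expand linear_sum scaler_sumr; apply: eq_bigr => j _.
  by rewrite linearZ /= scalerA tfun_tens.
Qed.

Lemma tfun_inj z z' : (forall i j, i \in s -> j \in s ->
  tfun (phi i) (phi j) z = tfun (phi i) (phi j) z') -> z = z'.
Proof.
move=> H; rewrite [z]tens_expand [RHS]tens_expand.
by apply: eq_big_seq => i si; apply: eq_big_seq => j sj; rewrite H.
Qed.

Hypothesis s_uniq : uniq s.
Hypothesis dual : forall i j, i \in s -> phi i (e j) = (j == i)%:R.

Definition tens_of (c : I -> I -> K) : tensor A A :=
  \sum_(i <- s) \sum_(j <- s) c i j *: tens (e i) (e j).

Lemma tfun_of c i j : i \in s -> j \in s ->
  tfun (phi i) (phi j) (tens_of c) = c i j.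
Proof.
move=> si sj; rewrite /tens_of linear_sum (bigD1_seq i) //= [X in _ + X]big1 ?addr0.
  rewrite linear_sum (bigD1_seq j) //= [X in _ + X]big1 ?addr0 => [|j' nj].
    by rewrite tfunZ tfun_tens !dual // !eqxx !mulr1.
  by rewrite tfunZ tfun_tens !dual // (negbTE nj) !mulr0.
move=> i' ni; rewrite linear_sum big1 // => j' _.
by rewrite /= tfunZ tfun_tens !dual // (negbTE ni) mul0r mulr0.
Qed.

End DualBasis.

Lemma frobenius_spaceP (D : A -> tensor A A) :
  frobenius_space A D <-> exists2 z, tens_central z & D = tens_lactl z.
Proof.
split=> [/open_frobenius_unit[cz De]|[z cz ->]]; last exact: open_frobenius_lact.
by exists (D 1) => //; apply/funext.
Qed.

Lemma frobenius_dim (T : finType) (z : T -> tensor A A) (f : T -> {linear tensor A A -> K^o}) :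
  (forall t, tens_central (z t)) -> (forall t s, f t (z s) = (t == s)%:R) ->
  (forall w, tens_central w -> (forall t, f t w = 0) -> w = 0) ->
  has_dim (frobenius_space A) #|T|.
Proof.
move=> cz dual sep.
pose D (t : T) (a : A) : tensor A A := tens_lactl (z t) a.
(* Evaluation at 1 recovers z from the coproduct a |-> az, so functionals on tensors become
   functionals on coproducts. *)
pose ev1 t (F : A -> tensor A A) : K^o := f t (F 1).
have ev1_lin t : linear (ev1 t).
  by move=> c F G; apply: (linearP (f t) c (F 1) (G 1)).
pose phi t : {linear (A -> tensor A A) -> K^o} :=
  HB.pack (ev1 t) (GRing.isLinear.Build K (A -> tensor A A) K^o _ (ev1 t) (ev1_lin t)).
apply: (@has_dim_dual K (A -> tensor A A) _ T D phi).
- apply/frobenius_spaceP; exists 0; last first.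
    by apply/funext => a; apply/esym/(tens_lact0 a).
  by move=> a; apply: etrans (tens_lact0 a) (esym (tens_ract0 a)).
- move=> c F G /frobenius_spaceP[y cy ->] /frobenius_spaceP[y' cy' ->].
  apply/frobenius_spaceP; exists (c *: y + y'); last first.
    apply/funext => a.
    have e := tens_lact_linr a c y y'.
    exact: (esym e).
  move=> a.
  have e := tens_lact_linr a c y y'.
  have e' := tens_ract_linr a c y y'.
  apply: etrans e _; apply: etrans _ (esym e').
  exact: (congr2 (fun s t => c *: s + t) (cy a) (cy' a)).
- by move=> t; apply/frobenius_spaceP; exists (z t).
- move=> t s; rewrite -dual; congr (f t _); exact: tens_lact1.
- move=> F /frobenius_spaceP[y cy ->] H.
  have y0 : y = 0.
    apply: sep => // t; rewrite -(H t); congr (f t _); exact/esym/tens_lact1.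
  by apply/funext => a; rewrite y0; apply: (tens_lact0 a).
Qed.

End TensorFunctionals.

(** * Balanced coefficients *)

Section PathCombinatorics.
Variable Q : quiver.
Implicit Types (p q r : qpath Q) (a b c : arrow Q) (x : vertex Q).

Definition starts b p := exists p0, pcomp (arrow_path b) p0 = Some p.
Definition ends b p := exists p0, pcomp p0 (arrow_path b) = Some p.
Definition left_maximal p := forall b r, pcomp (arrow_path b) p = Some r -> ~~ good r.
Definition right_maximal p := forall b r, pcomp p (arrow_path b) = Some r -> ~~ good r.

Lemma pcomp_ex p q : ptgt p = psrc q -> exists r, pcomp p q = Some r.
Proof. by move=> /pcompP[r -> _]; exists r. Qed.

Lemma startsP b p : starts b p -> psrc p = src b /\ exists l, parrows p = b :: l.
Proof.
by move=> [p0 e]; rewrite (psrc_comp e) (parrows_comp e); split=> //; exists (parrows p0).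
Qed.

Lemma endsP b p : ends b p -> ptgt p = tgt b /\ exists l, parrows p = rcons l b.
Proof.
move=> [p0 e]; rewrite (ptgt_pcomp e) (parrows_comp e); split=> //.
by exists (parrows p0); rewrite cats1.
Qed.

Lemma starts_inj b b' p : starts b p -> starts b' p -> b = b'.
Proof. by move=> /startsP[_ [l e]] /startsP[_ [l']]; rewrite e => -[]. Qed.

Lemma ends_inj b b' p : ends b p -> ends b' p -> b = b'.
Proof.
move=> /endsP[_ [l e]] /endsP[_ [l']]; rewrite e => /(congr1 (last b)).
by rewrite !last_rcons.
Qed.

Lemma starts_or_stationary p : p = stationary (psrc p) \/ exists b, starts b p.
Proof.
elim/qpath_ind: p => [x|b p r e _]; first by left.
by right; exists b, p.
Qed.

Lemma ends_or_stationary p : p = stationary (psrc p) \/ exists b, ends b p.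
Proof.
case: p => [[x l] /= w]; case/lastP: l w => [|l b] w; first by left; apply: qpath_eq.
right; exists b; have /andP[wl /eqP sb] : walk x l && (src b == last x (map (@tgt Q) l)).
  by rewrite -cats1 walk_cat /= andbT in w.
have [|r e] := @pcomp_ex (QPath (qpath_val := (x, l)) wl) (arrow_path b); first exact: esym.
exists (QPath (qpath_val := (x, l)) wl); rewrite e; congr Some; apply: qpath_eq.
  exact: psrc_comp e.
by rewrite (parrows_comp e) cats1.
Qed.

Lemma plen_starts b p : starts b p -> (0 < plen p)%N.
Proof. by move=> /startsP[_ [l e]]; rewrite /plen e. Qed.

Lemma plen_ends b p : ends b p -> (0 < plen p)%N.
Proof. by move=> /endsP[_ [l e]]; rewrite /plen e size_rcons. Qed.

Lemma plen_gt0_starts p : (0 < plen p)%N -> exists b, starts b p.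
Proof. by case: (starts_or_stationary p) => // ->. Qed.

Lemma plen_gt0_ends p : (0 < plen p)%N -> exists b, ends b p.
Proof. by case: (ends_or_stationary p) => // ->. Qed.

Lemma good_junction a b p q r : ends a p -> starts b q -> good p -> good q ->
  pcomp p q = Some r -> good r = ~~ crel a b.
Proof.
rewrite /good /admissible => /endsP[_ [l ep]] /startsP[_ [m eq]].
move=> gp gq /parrows_comp ->; rewrite ep eq cat_rcons sorted_cat_cons -ep gp /=.
by rewrite -[path _ b m]/(sorted _ (b :: m)) -eq gq andbT.
Qed.

Lemma good_starts a b p r : starts b p -> good p -> pcomp (arrow_path a) p = Some r ->
  good r = ~~ crel a b.
Proof.
move=> sb gp; apply: good_junction => //; exists (stationary (src a)).
by rewrite pcomp_stationaryl eqxx.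
Qed.

Lemma good_ends a b p r : ends a p -> good p -> pcomp p (arrow_path b) = Some r ->
  good r = ~~ crel a b.
Proof.
move=> sb gp; apply: good_junction => //; exists (stationary (tgt b)).
by rewrite pcomp_stationaryr eqxx.
Qed.

(* Besides the basis paths, only the stationary path at an isolated vertex is
   basic (this is the case of one vertex). *)
Definition basic p := [/\ good p, left_maximal p, right_maximal p,
  forall b, src b = psrc p -> starts b p & forall b, tgt b = ptgt p -> ends b p].

(** The vertex between a and b is then special, see [specialP]. *)
Definition corner_at a b := [/\ crel a b, forall a', tgt a' = tgt a -> a' = a
  & forall b', src b' = src b -> b' = b].

(** The pair is ordered as in p (x) q, but the paths meet as q followed by p, and this product is
    zero. *)
Definition corner (pq : qpath Q * qpath Q) := [/\ good pq.1, good pq.2 &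
  exists a b, [/\ ends a pq.2, starts b pq.1 & corner_at a b]].

(** An arrow that composes with p on the left must be a, and ab is a relation; dually for q. Hence
    no shift moves the pair. *)
Lemma corner_maximal p q : corner (p, q) -> left_maximal p /\ right_maximal q.
Proof.
move=> [gp gq [a [b [eq sp [ab ina outb]]]]].
have [sb _] := startsP sp; have [tq _] := endsP eq; have tab := crel_comp ab.
split=> [a'|b'] r e; have ej := comp_junction e.
  rewrite (good_starts sp gp e) negbK (ina a') // tab.
  by rewrite -sb -ej.
rewrite (good_ends eq gq e) negbK (outb b') // -tab -tq.
exact: esym.
Qed.

End PathCombinatorics.

Section Balanced.
Local Open Scope ring_scope.
Variables (K : fieldType) (Q : quiver).
Implicit Types (p q r : qpath Q) (a b : arrow Q) (c : qpath Q -> qpath Q -> K).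

(* [c p q] stands for the coefficient of [p (x) q] in a tensor z with az = za for
   all a; in a nonzero coefficient the paths compose in the order [pcomp q p]. *)
Record balanced c := Balanced {
  balanced_junction : forall p q, good p -> good q -> ptgt q <> psrc p -> c p q = 0;
  balanced_shift : forall b p p' q q', good p' -> good q' ->
    pcomp (arrow_path b) p = Some p' -> pcomp q (arrow_path b) = Some q' ->
    c p q' = c p' q;
  balanced_left : forall b p p' q, good p' -> good q ->
    pcomp (arrow_path b) p = Some p' -> ~ ends b q -> c p q = 0;
  balanced_right : forall b p q q', good p -> good q' ->
    pcomp q (arrow_path b) = Some q' -> ~ starts b p -> c p q = 0
}.

Lemma balanced_ext c c' : (forall p q, good p -> good q -> c p q = c' p q) ->
  balanced c -> balanced c'.
Proof.
move=> e [c1 c2 c3 c4]; split=> [p q gp gq|b p p' q q' gp gq ep eq|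
  b p p' q gp gq ep|b p q q' gp gq eq].
- by rewrite -e //; apply: c1.
- have [_ gp0] := good_comp ep gp; have [gq0 _] := good_comp eq gq.
  by rewrite -!e //; apply: c2 ep eq.
- by have [_ gp0] := good_comp ep gp; rewrite -e //; apply: c3 ep.
- by have [gq0 _] := good_comp eq gq; rewrite -e //; apply: c4 eq.
Qed.

(** Shifts preserve the product qp by associativity. If bp is nonzero and neither factor is
    stationary, [crel_in] forces b to be the arrow of P just before p; at the ends of P the clauses
    of [basic] take over. The right-hand condition is dual, with [crel_out]. *)
Lemma balanced_basic (k : nat) P : mutation_class_A Q k -> basic P ->
  balanced (fun p q => (pcomp q p == Some P)%:R).
Proof.
move=> hQ [gP lP rP oP iP]; split=> [p q gp gq n|b p p' q q' gp gq ep eq|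
  b p p' q gp gq ep n|b p q q' gp gq eq n].
- by rewrite pcompN.
- by have := pcompA q (arrow_path b) p; rewrite ep eq /= => ->.
- case: eqP => // eP; case: n; have tb := comp_junction ep; have tq := comp_junction eP.
  have [_ gp0] := good_comp ep gp.
  case: (starts_or_stationary p) => [ps|[c sp]].
    have qP : q = P by move: eP; rewrite ps pcomp_stationaryr; case: ifP => // _ [].
    by rewrite qP; apply: iP; rewrite -qP tq -tb.
  case: (ends_or_stationary q) => [qs|[d ed]].
    have pP : p = P by move: eP; rewrite qs pcomp_stationaryl; case: ifP => // _ [].
    by move: ep; rewrite pP => /lP; rewrite gp.
  have [sc _] := startsP sp; have [td _] := endsP ed.
  suff -> : b = d by [].
  apply: (crel_in hQ (b := c)); rewrite -?sc -?td //.
    by rewrite -(good_starts sp gp0 ep).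
  by rewrite -(good_junction ed sp gq gp0 eP).
- case: eqP => // eP; case: n; have tb := comp_junction eq; have tq := comp_junction eP.
  have [gq0 _] := good_comp eq gq.
  case: (ends_or_stationary q) => [qs|[d ed]].
    have pP : p = P by move: eP; rewrite qs pcomp_stationaryl; case: ifP => // _ [].
    by rewrite pP; apply: oP; rewrite -pP -tq tb.
  case: (starts_or_stationary p) => [ps|[c sp]].
    have qP : q = P by move: eP; rewrite ps pcomp_stationaryr; case: ifP => // _ [].
    by move: eq; rewrite qP => /rP; rewrite gq.
  have [sc _] := startsP sp; have [td _] := endsP ed.
  suff -> : b = c by [].
  apply: (crel_out hQ (a := d)); rewrite -?sc -?td //.
    by rewrite -(good_ends ed gq0 eq).
  by rewrite -(good_junction ed sp gq0 gp eP).
Qed.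

Lemma balanced_corner P0 Q0 : corner (P0, Q0) ->
  balanced (fun p q => ((p == P0) && (q == Q0))%:R).
Proof.
move=> cPQ; have [lP rQ] := corner_maximal cPQ.
have [gP gQ [a0 [b0 [eQ sP [ab _ _]]]]] := cPQ.
have nj : ptgt Q0 = psrc P0.
  by rewrite (endsP eQ).1 (startsP sP).1 (crel_comp ab).
have nl b p p' : good p' -> pcomp (arrow_path b) p = Some p' -> (p == P0) = false.
  by move=> gp ep; apply/eqP=> pP; move: gp; rewrite pP in ep; apply/negP/(lP _ _ ep).
have nr b q q' : good q' -> pcomp q (arrow_path b) = Some q' -> (q == Q0) = false.
  by move=> gq eq; apply/eqP=> qQ; move: gq; rewrite qQ in eq; apply/negP/(rQ _ _ eq).
split=> [p q gp gq n|b p p' q q' gp gq ep eq|b p p' q gp gq ep _|b p q q' gp gq eq _].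
- by case: andP => // -[/eqP pP /eqP qQ]; case: n; rewrite pP qQ.
- by rewrite (nl _ _ _ gp ep) (nr _ _ _ gq eq) andbF.
- by rewrite (nl _ _ _ gp ep).
- by rewrite (nr _ _ _ gq eq) andbF.
Qed.

(* Shifting arrows from the right factor to the left one, one at a time. *)
Lemma balanced_transport c p q r : balanced c -> pcomp q p = Some r -> good r ->
  c p q = c r (stationary (psrc r)).
Proof.
move=> bc; have [n] := ubnP (plen q); elim: n q p r => // n IH q p r qn e gr.
case: (ends_or_stationary q) => [qs|[a [q0 eq]]].
  have pr : p = r by move: e; rewrite qs pcomp_stationaryl; case: ifP => // _ [].
  by rewrite (psrc_comp e) -qs pr.
have := pcompA q0 (arrow_path a) p; rewrite eq /= e.
case ep: (pcomp (arrow_path a) p) => [p'|] //= /esym eq0.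
have [_ gp'] := good_comp eq0 gr; have [gq _] := good_comp e gr.
rewrite (balanced_shift bc gp' gq ep eq); apply: IH eq0 gr.
by move: qn; rewrite (pcomp_len eq) addn1.
Qed.

(** Shift arrows from q to p. Once q is used up, the coefficient vanishes unless p is basic. If a
    relation ab blocks a shift, any other arrow a' into the junction gives a nonzero a'p, as b has
    only one relation on its left; q does not end with a', so the coefficient vanishes. Dually for
    another outgoing arrow; with neither, the pair is a corner. *)
Lemma balanced_eq0 k c : mutation_class_A Q k -> balanced c ->
  (forall p, basic p -> c p (stationary (psrc p)) = 0) ->
  (forall p q, corner (p, q) -> c p q = 0) ->
  forall p q, good p -> good q -> c p q = 0.
Proof.
move=> hQ bc cB cC p q; have [n] := ubnP (plen q); elim: n p q => // n IH p q qn gp gq.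
have [pq|npq] := ptgt q =P psrc p; last exact: (balanced_junction bc).
case: (ends_or_stationary q) => [qs|[a eq]].
  rewrite qs; rewrite qs in pq; rewrite -[psrc q]/(ptgt (stationary (psrc q))) pq.
  set s := stationary (psrc p); set t := stationary (ptgt p).
  have ps : pcomp s p = Some p by rewrite pcomp_stationaryl eqxx.
  have pt : pcomp p t = Some p by rewrite pcomp_stationaryr eqxx.
  (* The two extreme cuttings of p carry the same coefficient, so extensions at the target can be
     tested on [c t p]. *)
  have tr : c p s = c t p by rewrite (balanced_transport bc pt).
  have [bp|nb] := pselect (basic p); first exact: cB.
  apply: contrapT => c0; apply: nb; split=> // [b r e|b r e|b sb|b tb].
  - apply/negP => gr; apply: c0; apply: (balanced_left bc gr _ e) => //.
    by move=> /plen_ends.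
  - apply/negP => gr; apply: c0; rewrite tr; apply: (balanced_right bc _ gr e) => //.
    by move=> /plen_starts.
  - apply: contrapT => ns; apply: c0.
    (* Appending b to the stationary right factor gives the nonzero path b, and p does not start
       with b. *)
    apply: (@balanced_right _ bc b _ _ (arrow_path b)) ns => //.
    by rewrite pcomp_stationaryl /psrc /= sb eqxx.
  - apply: contrapT => ns; apply: c0; rewrite tr.
    apply: (@balanced_left _ bc b _ (arrow_path b)) ns => //.
    by rewrite pcomp_stationaryr /ptgt /= tb eqxx.
have [q0 eq0] := eq; have ta : tgt a = psrc p by rewrite -(endsP eq).1.
have [p' ep] := @pcomp_ex _ (arrow_path a) p ta.
have [gp'|ngp'] := boolP (good p').
  rewrite (balanced_shift bc gp' gq ep eq0); apply: IH => //.
    by move: qn; rewrite (pcomp_len eq0) addn1.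
  exact: (good_comp eq0 gq).1.
case: (starts_or_stationary p) => [ps|[b sp]].
  move: ngp'; have -> // : p' = arrow_path a.
  by move: ep; rewrite ps pcomp_stationaryr; case: ifP => // _ [].
rewrite (good_starts sp gp ep) negbK in ngp'.
have [sb _] := startsP sp; have [tq _] := endsP eq.
apply: contrapT => c0; apply: (c0); apply: cC; split=> //; exists a, b; split=> //.
split=> // [a' ta'|b' sb'].
  apply: contrapT => naa'; apply: c0.
  have [r er] : exists r, pcomp (arrow_path a') p = Some r.
    by apply: pcomp_ex; rewrite -ta -ta'.
  apply: (balanced_left bc _ gq er) => [|/(ends_inj eq)/esym //].
  by rewrite (good_starts sp gp er); apply/negP => /(crel_injl hQ ngp')/esym.
apply: contrapT => nbb'; apply: c0.
have [r er] : exists r, pcomp q (arrow_path b') = Some r.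
  by apply: pcomp_ex; rewrite pq sb -sb'.
apply: (balanced_right bc gp _ er) => [|/(starts_inj sp)/esym //].
by rewrite (good_ends eq gq er); apply/negP => /(crel_injr hQ ngp')/esym.
Qed.

End Balanced.

(** * The Frobenius space *)

Section ActionCoefficients.
Local Open Scope ring_scope.
Variables (K : fieldType) (Q : quiver) (c L R : qpath Q -> qpath Q -> K).
Hypothesis bc : balanced c.
Implicit Types p q r : qpath Q.

(** [L] and [R] stand for the coefficients of bz and zb. Whether p starts and q ends with b decides
    which clause of [balanced] applies; if neither holds, both sides vanish. *)
Lemma balanced_actions_arrow b :
  (forall p q r, good r -> pcomp (arrow_path b) p = Some r -> L r q = c p q) ->
  (forall q r, ~ starts b r -> L r q = 0) ->
  (forall p q r, good r -> pcomp q (arrow_path b) = Some r -> R p r = c p q) ->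
  (forall p r, ~ ends b r -> R p r = 0) ->
  forall p q, good p -> good q -> L p q = R p q.
Proof.
move=> L1 L0 R1 R0 p q gp gq.
have [[p0 ep]|np] := pselect (starts b p); have [[q0 eq]|nq] := pselect (ends b q).
- by rewrite (L1 _ _ _ gp ep) (R1 _ _ _ gq eq) (balanced_shift bc gp gq ep eq).
- by rewrite (L1 _ _ _ gp ep) (balanced_left bc gp gq ep nq) R0.
- by rewrite (R1 _ _ _ gq eq) (balanced_right bc gp gq eq np) L0.
- by rewrite L0 ?R0.
Qed.

Lemma balanced_actions_stationary x :
  (forall p q r, good r -> pcomp (stationary x) p = Some r -> L r q = c p q) ->
  (forall q r, (forall p, pcomp (stationary x) p <> Some r) -> L r q = 0) ->
  (forall p q r, good r -> pcomp q (stationary x) = Some r -> R p r = c p q) ->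
  (forall p r, (forall q, pcomp q (stationary x) <> Some r) -> R p r = 0) ->
  forall p q, good p -> good q -> L p q = R p q.
Proof.
move=> L1 L0 R1 R0 p q gp gq.
have -> : L p q = if x == psrc p then c p q else 0.
  case: eqP => [xp|nxp]; [apply: L1 gp _|apply: L0 => p0]; rewrite pcomp_stationaryl.
    by rewrite xp eqxx.
  by case: eqP => // e1 [e2]; case: nxp; rewrite -e2.
have -> : R p q = if ptgt q == x then c p q else 0.
  case: eqP => [xp|nxp]; [apply: R1 gq _|apply: R0 => p0]; rewrite pcomp_stationaryr.
    by rewrite xp eqxx.
  by case: eqP => // e1 [e2]; case: nxp; rewrite -e2.
have [pq|npq] := ptgt q =P psrc p; first by rewrite -pq eq_sym.
by rewrite (balanced_junction bc) // !if_same.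
Qed.

End ActionCoefficients.

Section PathFrobenius.
Local Open Scope ring_scope.
Local Opaque tens tens_lact tens_ract tfun tens_of.
Variables (K : fieldType) (Q : quiver) (k : nat) (A : algType K).
Variables (e : qpath Q -> A) (phi : qpath Q -> {linear A -> K^o}) (N : {fset qpath Q}).
Hypothesis NP : forall p, (p \in N) = good p.
Hypothesis eM : forall p q r, pcomp p q = Some r -> e p * e q = e r.
Hypothesis dual : forall p q, good p -> phi p (e q) = (q == p)%:R.
Hypothesis expand : forall u, u = \sum_(p <- N) (phi p u : K) *: e p.
Hypothesis phi_mull : forall p q r u, good r -> pcomp p q = Some r ->
  phi r (e p * u) = phi q u.
Hypothesis phi_mull0 : forall p r u, (forall q, pcomp p q <> Some r) -> phi r (e p * u) = 0.
Hypothesis phi_mulr : forall p q r u, good r -> pcomp p q = Some r ->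
  phi r (u * e q) = phi p u.
Hypothesis phi_mulr0 : forall q r u, (forall p, pcomp p q <> Some r) -> phi r (u * e q) = 0.
Implicit Types (p q r : qpath Q) (a b : arrow Q) (z : tensor A A).

Let coef z p q : K := tfun (phi p) (phi q) z.

Lemma coef_lact p q r q' z : good r -> pcomp p q = Some r ->
  coef (tens_lact (e p) z) r q' = coef z q q'.
Proof. by move=> gr er; apply: tfun_lact => u; apply: phi_mull er. Qed.

Lemma coef_lact0 p r q' z : (forall q, pcomp p q <> Some r) ->
  coef (tens_lact (e p) z) r q' = 0.
Proof. by move=> er; apply: tfun_lact0 => u; apply: phi_mull0 er. Qed.

Lemma coef_ract p q r p' z : good r -> pcomp p q = Some r ->
  coef (tens_ract (e q) z) p' r = coef z p' p.
Proof. by move=> gr er; apply: tfun_ract => u; apply: phi_mulr er. Qed.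

Lemma coef_ract0 q r p' z : (forall p, pcomp p q <> Some r) ->
  coef (tens_ract (e q) z) p' r = 0.
Proof. by move=> er; apply: tfun_ract0 => u; apply: phi_mulr0 er. Qed.

(** Each clause compares one coefficient of az and za, with a a stationary path for the junction and
    an arrow for the others. *)
Lemma central_balanced z : tens_central z -> balanced (coef z).
Proof.
move=> cz; split=> [p q gp gq n|b p p' q q' gp gq ep eq|
  b p p' q gp gq ep n|b p q q' gp gq eq n].
- rewrite -(@coef_lact (stationary (psrc p)) p p q z gp); last first.
    by rewrite pcomp_stationaryl eqxx.
  rewrite (cz _) coef_ract0 // => q0; rewrite pcomp_stationaryr.
  by case: eqP => // e1 [e2]; case: n; rewrite -e2.
- by rewrite -(coef_lact q' z gp ep) (cz _) (coef_ract p' z gq eq).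
- by rewrite -(coef_lact q z gp ep) (cz _) coef_ract0 // => q0 eq; apply: n; exists q0.
- by rewrite -(coef_ract p z gq eq) -(cz _) coef_lact0 // => p0 ep; apply: n; exists p0.
Qed.

Lemma balanced_central z : balanced (coef z) -> tens_central z.
Proof.
move=> bz.
have zst x : tens_lact (e (stationary x)) z = tens_ract (e (stationary x)) z.
  apply: (tfun_inj expand) => p q; rewrite !NP => gp gq.
  apply: (@balanced_actions_stationary K Q (coef z) (coef (tens_lact (e (stationary x)) z))
    (coef (tens_ract (e (stationary x)) z)) bz x _ _ _ _ p q gp gq).
  - by move=> p1 q1 r gr er; exact: (coef_lact q1 z gr er).
  - by move=> q1 r er; exact: (coef_lact0 q1 z er).
  - by move=> p1 q1 r gr er; exact: (coef_ract p1 z gr er).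
  - by move=> p1 r er; exact: (coef_ract0 p1 z er).
have zar b : tens_lact (e (arrow_path b)) z = tens_ract (e (arrow_path b)) z.
  apply: (tfun_inj expand) => p q; rewrite !NP => gp gq.
  apply: (@balanced_actions_arrow K Q (coef z) (coef (tens_lact (e (arrow_path b)) z))
    (coef (tens_ract (e (arrow_path b)) z)) bz b _ _ _ _ p q gp gq).
  - by move=> p1 q1 r gr er; exact: (coef_lact q1 z gr er).
  - by move=> q1 r nr; apply: (coef_lact0 q1 z) => p1 er; apply: nr; exists p1.
  - by move=> p1 q1 r gr er; exact: (coef_ract p1 z gr er).
  - by move=> p1 r nr; apply: (coef_ract0 p1 z) => q1 er; apply: nr; exists q1.
have zp p : tens_lact (e p) z = tens_ract (e p) z.
  elim/qpath_ind: p => [x|b p r er IH]; first exact: zst.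
  rewrite -(eM er).
  exact: (tens_central_mul (zar b) IH).
move=> a; rewrite [a]expand; exact: (tens_central_sum _ _ zp).
Qed.

Hypothesis hQ : mutation_class_A Q k.
Variables (B : {fset qpath Q}) (C : {fset qpath Q * qpath Q}).
Hypothesis BP : forall p, p \in B <-> basic p.
Hypothesis CP : forall pq, pq \in C <-> corner pq.

(* The coproducts dual to [B] are the sums of all [p (x) q] with qp = P, and those
   dual to [C] are the single tensors [p (x) q]. *)
Lemma frobenius_path_dim : has_dim (frobenius_space A) (#|` B| + #|` C|).
Proof.
pose c (t : (B + C)%type) p q : K := match t with
  | inl P => (pcomp q p == Some (fsval P))%:R
  | inr pq => ((p == (fsval pq).1) && (q == (fsval pq).2))%:R end.
have bc t : balanced (c t).
  case: t => [P|[[p q] pqC]].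
    by apply: (balanced_basic K hQ); apply/BP/fsvalP.
  by apply: balanced_corner; apply/CP.
(* One pair per chain suffices to read its coefficient; for a basic path it is the cutting with
   stationary right factor. *)
pose rep (t : (B + C)%type) := match t with
  | inl P => (fsval P, stationary (psrc (fsval P))) | inr pq => fsval pq end.
have rep_good t : good (rep t).1 /\ good (rep t).2.
  by case: t => [P|pq]; [have /BP[] := fsvalP P|have /CP[] := fsvalP pq].
pose z t := tens_of N e (c t).
have coefz t p q : good p -> good q -> coef (z t) p q = c t p q.
  by move=> gp gq; apply: tfun_of; rewrite ?NP // => p' q'; rewrite NP; apply: dual.
have cz t : tens_central (z t).
  apply: balanced_central; apply: balanced_ext (bc t) => p q gp gq.
  by rewrite coefz.
have -> : (#|` B| + #|` C|)%N = #|{: B + C}| by rewrite card_sum !cardfE.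
apply: (@frobenius_dim _ _ _ z (fun t => tfun (phi (rep t).1) (phi (rep t).2)) cz).
  move=> t s; have [g1 g2] := rep_good t.
  apply: etrans (coefz s (rep t).1 (rep t).2 g1 g2) _.
  case: t s g1 g2 => [P|pq] [P'|pq'] /= _ _.
  - by rewrite pcomp_stationaryl eqxx -[inl P == inl P']/(P == P') -val_eqE.
  (* The right factor of a corner has positive length, so it is not stationary. *)
  - have /CP[_ _ [a [b [/plen_ends + _ _]]]] := fsvalP pq'.
    by case: eqP => //= _; case: eqP => //= <-.
  (* At a corner qp contains a relation, so it is not a basic path. *)
  - have /CP[gp gq [a [b [ea sb [ab _ _]]]]] := fsvalP pq.
    have /BP[gP _ _ _ _] := fsvalP P'.
    case: eqP => // eP; move: gP.
    by rewrite (good_junction ea sb gq gp eP) ab.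
  - have -> // : (inr pq == inr pq' :> B + C) =
      ((fsval pq).1 == (fsval pq').1) && ((fsval pq).2 == (fsval pq').2) by [].
move=> w cw w0; apply: (tfun_inj expand) => p q; rewrite !NP => gp gq.
rewrite (tfun0 (phi p) (phi q)).
apply: (balanced_eq0 hQ (central_balanced cw)) => // [P /BP PB|p' q' /CP pqC].
  exact: (w0 (inl [` PB]%fset)).
exact: (w0 (inr [` pqC]%fset)).
Qed.

End PathFrobenius.

(** * Counting *)

Section Finiteness.
Variables (Q : quiver) (k : nat).
Hypothesis hQ : mutation_class_A Q k.

Lemma good_finite : finite_set [set p : qpath Q | good p]%classic.
Proof.
(* Lengths below the number of vertices suffice by [admissible_size]; [insub] then keeps the words
   that are walks. *)
pose words := flatten
  [seq [seq val t | t <- enum {: i.-tuple (arrow Q)}] | i <- iota 0 #|vertex Q|].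
pose s := pmap (fun t => insub t : option (qpath Q))
  [seq (x, l) | x <- enum (vertex Q), l <- words].
have fs : finite_set [set` s]%classic by apply/finite_seqP; exists s.
apply: sub_finite_set fs => p /= gp; rewrite /s mem_pmap; apply/mapP.
exists (val p); last by rewrite valK.
apply/allpairsP; exists (psrc p, parrows p); split => /=; first by rewrite mem_enum.
  apply/flattenP; exists [seq val t | t <- enum {: (plen p).-tuple (arrow Q)}].
    apply/mapP; exists (plen p) => //; rewrite mem_iota /= add0n.
    exact: (admissible_size hQ (valP p)).
  by apply/mapP; exists (in_tuple (parrows p)) => //; rewrite mem_enum.
exact: surjective_pairing.
Qed.

End Finiteness.

Lemma mem_fset_set (T : choiceType) (S : set T) x : finite_set S ->
  x \in fset_set S <-> S x.
Proof. by move=> fS; rewrite in_fset_set // in_setE. Qed.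

(** The lengths in P are distinct and fill an interval 1, ..., M, so the maximal length is the
    number of paths. This turns counts into the lengths of the formula. *)
Lemma longestE (Q : quiver) (P : set (qpath Q)) (F : {fset qpath Q}) :
  (forall p, p \in F <-> P p) -> (exists p, P p) -> (forall p, P p -> (0 < plen p)%N) ->
  (forall p p', P p -> P p' -> plen p = plen p' -> p = p') ->
  (forall p m, P p -> (0 < m <= plen p)%N -> exists2 p', P p' & plen p' = m) ->
  longest P = #|` F|.
Proof.
move=> FP [p0 Pp0] pos inj down.
pose len n := has (fun p => plen p == n) F.
have exlen : exists n, len n.
  by exists (plen p0); apply/hasP; exists p0 => //; apply/FP.
have ublen n : len n -> (n <= \max_(p <- F) plen p)%N.
  by move=> /hasP[p pF /eqP <-]; apply: leq_bigmax_seq.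
have [M /hasP[p pF /eqP pM] maxM] := ex_maxnP exlen ublen.
have maxP q : P q -> (plen q <= M)%N.
  by move=> /FP qF; apply: maxM; apply/hasP; exists q.
have -> : #|` F| = M.
  rewrite -(size_iota 1 M) -(size_map (@plen Q)); apply/perm_size/uniq_perm.
  - rewrite map_inj_in_uniq ?fset_uniq // => q q' /FP qF /FP q'F; exact: inj.
  - exact: iota_uniq.
  move=> n; rewrite mem_iota add1n ltnS; apply/mapP/idP => [[q /FP qF ->]|nM].
    by rewrite pos // maxP.
  rewrite -pM in nM; have [q Pq qn] := down p n ((FP p).1 pF) nM.
  by exists q => //; apply/FP.
apply: xget_unique => [|n [[q Pq qn] nmax]].
  by split=> //; exists p => //; apply/FP.
by apply/eqP; rewrite eqn_leq -{1}qn maxP // -pM nmax //; apply/FP.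
Qed.

Lemma path_det (T : eqType) (e : rel T) x s s' :
  (forall x y y', e x y -> e x y' -> y = y') -> path e x s -> path e x s' ->
  size s = size s' -> s = s'.
Proof.
move=> det; elim: s s' x => [|y s IH] [|y' s'] //= x /andP[xy ps] /andP[xy' ps'] [ss].
have yy' := det _ _ _ xy xy'; rewrite -yy' in ps' *.
by rewrite (IH _ _ ps ps').
Qed.

Section Counting.
Variables (K : fieldType) (Q : quiver) (k : nat).
Hypothesis hQ : mutation_class_A Q k.
Implicit Types (p q r : qpath Q) (a b : arrow Q) (v : vertex Q).

Let step a b := (tgt a == src b) && ~~ crel a b.

Lemma good_step p : good p -> sorted step (parrows p).
Proof.
move=> gp; rewrite (@sorted_relI _ (fun a b => tgt a == src b)); apply/andP; split=> //.
have := valP p; rewrite -/(psrc p) -/(parrows p); case: (parrows p) => // a l.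
by rewrite walk_path => /andP[].
Qed.

Lemma starts_det b p p' : good p -> good p' -> starts b p -> starts b p' ->
  plen p = plen p' -> p = p'.
Proof.
move=> /good_step gp /good_step gp' /startsP[sp [l e]] /startsP[sp' [l' e']].
rewrite /plen e e' => -[ll']; apply: qpath_eq; first by rewrite sp sp'.
rewrite e e' in gp gp' *; congr cons; apply: path_det gp gp' ll' => x y y'.
by move=> /andP[/eqP e1 n1] /andP[/eqP e2 n2]; apply: (crel_out hQ e1 e2).
Qed.

Lemma ends_det a p p' : good p -> good p' -> ends a p -> ends a p' ->
  plen p = plen p' -> p = p'.
Proof.
move=> /good_step gp /good_step gp' ep ep' pp'.
have arr : parrows p = parrows p'.
  move: ep ep' => /endsP[_ [l e]] /endsP[_ [l' e']].
  (* Reversal makes the last arrow the starting point, and [crel_in] gives determinism backwards. *)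
  rewrite e -[rcons l a]revK rev_sorted rev_rcons /= in gp.
  rewrite e' -[rcons l' a]revK rev_sorted rev_rcons /= in gp'.
  have ss : size (rev l) = size (rev l').
    by move: pp'; rewrite /plen e e' !size_rcons !size_rev => -[].
  rewrite e e' -[l]revK -[l']revK; congr (rcons (rev _) a).
  apply: path_det gp gp' ss => x y y'.
  by move=> /andP[/eqP e1 n1] /andP[/eqP e2 n2]; apply: (crel_in hQ e1 e2).
apply: qpath_eq => //.
have [b sb] := plen_gt0_starts (plen_ends ep).
have [b' sb'] := plen_gt0_starts (plen_ends ep').
rewrite (startsP sb).1 (startsP sb').1.
by move: (startsP sb).2 (startsP sb').2 => [l e] [l']; rewrite -arr e => -[->].
Qed.

Lemma pcomp_split p n : (n <= plen p)%N ->
  exists q r, pcomp q r = Some p /\ plen q = n.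
Proof.
move=> np; have := valP p; rewrite -/(psrc p) -/(parrows p).
rewrite -{1}(cat_take_drop n (parrows p)) walk_cat => /andP[w1 w2].
pose q := QPath (qpath_val := (psrc p, take n (parrows p))) w1.
pose r := QPath (qpath_val := (last (psrc p) (map (@tgt Q) (take n (parrows p))), _)) w2.
exists q, r; split; last by rewrite /plen /= size_take_min; apply/minn_idPl.
have [s es] := @pcomp_ex _ q r erefl; rewrite es; congr Some; apply: qpath_eq.
  exact: psrc_comp es.
by rewrite (parrows_comp es) cat_take_drop.
Qed.

(** The numbers of incoming and outgoing arrows are positive and add up to two, so each is one. *)
Lemma specialP v :
  reflect (exists a b, [/\ corner_at a b, tgt a = v & src b = v]) (special K v).
Proof.
apply: (iffP andP) => [[/eqP v2]|[a [b [[ab ina outb] ta sb]]]].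
  case/existsP=> a /existsP[b /and3P[/eqP ta /eqP sb]].
  rewrite arrows_in_saturation_ideal ?ta ?sb // => ab; exists a, b; split=> //.
  have ia : a \in [set a | @tgt Q a == v] by rewrite inE ta.
  have ob : b \in [set b | @src Q b == v] by rewrite inE sb.
  have i1 : (0 < #|[set a | @tgt Q a == v]|)%N by apply/card_gt0P; exists a.
  have o1 : (0 < #|[set b | @src Q b == v]|)%N by apply/card_gt0P; exists b.
  have /cards1P[a0 Ea] : #|[set a | @tgt Q a == v]| == 1%N.
    by rewrite eqn_leq i1 andbT -(leq_add2l 1) -[(1 + 1)%N]v2 leq_add2r.
  have /cards1P[b0 Eb] : #|[set b | @src Q b == v]| == 1%N.
    by rewrite eqn_leq o1 andbT -(leq_add2r 1) -[(1 + 1)%N]v2 leq_add2l.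
  split=> // [a' ta'|b' sb'].
    have : a' \in [set a | @tgt Q a == v] by rewrite inE ta' ta.
    by move: ia; rewrite Ea => /set1P -> /set1P.
  have : b' \in [set b | @src Q b == v] by rewrite inE sb' sb.
  by move: ob; rewrite Eb => /set1P -> /set1P.
have Ea : [set a | @tgt Q a == v] = [set a].
  apply/setP=> a'; rewrite !inE; apply/eqP/eqP => [ta'|->] //.
  by apply: ina; rewrite ta' ta.
have Eb : [set b | @src Q b == v] = [set b].
  apply/setP=> b'; rewrite !inE; apply/eqP/eqP => [sb'|->] //.
  by apply: outb; rewrite sb' sb.
rewrite /valency Ea Eb !cards1; split=> //; apply/existsP; exists a; apply/existsP; exists b.
by rewrite ta sb !eqxx arrows_in_saturation_ideal ?ta ?sb.
Qed.

Lemma special_paths_from v p : special K v -> nonzero_paths Q K p -> psrc p = v ->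
  forall b, src b = v -> starts b p.
Proof.
move=> /specialP[a [b [[_ _ outb] _ sb]]] /nonzero_pathsE[/plen_gt0_starts[b' sp] _] pv b1 sb1.
by rewrite (outb b1) ?sb1 ?sb // -(outb b') // -(startsP sp).1 pv sb.
Qed.

Lemma special_paths_to v p : special K v -> nonzero_paths Q K p -> ptgt p = v ->
  forall a, tgt a = v -> ends a p.
Proof.
move=> /specialP[a [b [[_ ina _] ta _]]] /nonzero_pathsE[/plen_gt0_ends[a' ep] _] pv a1 ta1.
by rewrite (ina a1) ?ta1 ?ta // -(ina a') // -(endsP ep).1 pv ta.
Qed.

Lemma nonzero_arrow b : nonzero_paths Q K (arrow_path b).
Proof. exact/nonzero_pathsE. Qed.

Lemma longest_fromE v (F : {fset qpath Q}) : special K v ->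
  (forall p, p \in F <-> nonzero_paths Q K p /\ psrc p = v) -> longest_from K v = #|` F|.
Proof.
move=> sv FP; have /specialP[a [b [_ _ sb]]] := sv; apply: longestE FP _ _ _ _.
- by exists (arrow_path b); split=> //; apply: nonzero_arrow.
- by move=> p [/nonzero_pathsE[]].
- move=> p p' [np pv] [np' pv']; have /nonzero_pathsE[_ gp] := np.
  have /nonzero_pathsE[_ gp'] := np'; apply: (starts_det gp gp').
    exact: special_paths_from sv np pv _ sb.
  exact: special_paths_from sv np' pv' _ sb.
move=> p m [/nonzero_pathsE[_ gp] pv] /andP[m0 mp].
have [q [r [e qm]]] := pcomp_split mp; exists q => //; split.
  by apply/nonzero_pathsE; rewrite qm; split=> //; case: (good_comp e gp).
by rewrite -(psrc_comp e).
Qed.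

Lemma longest_toE v (F : {fset qpath Q}) : special K v ->
  (forall p, p \in F <-> nonzero_paths Q K p /\ ptgt p = v) -> longest_to K v = #|` F|.
Proof.
move=> sv FP; have /specialP[a [b [_ ta _]]] := sv; apply: longestE FP _ _ _ _.
- by exists (arrow_path a); split=> //; apply: nonzero_arrow.
- by move=> p [/nonzero_pathsE[]].
- move=> p p' [np pv] [np' pv']; have /nonzero_pathsE[_ gp] := np.
  have /nonzero_pathsE[_ gp'] := np'; apply: (ends_det gp gp').
    exact: special_paths_to sv np pv _ ta.
  exact: special_paths_to sv np' pv' _ ta.
move=> p m [/nonzero_pathsE[_ gp] pv] /andP[m0 mp].
(* Paths into v are shortened at the front: dropping [plen p - m] arrows leaves a suffix of length
   m. *)
have [q [r [e qm]]] := @pcomp_split p (plen p - m) (leq_subr _ _).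
have rm : plen r = m by apply: (@addnI (plen q)); rewrite -(pcomp_len e) qm subnK.
exists r => //; split; last by rewrite -(ptgt_pcomp e).
by apply/nonzero_pathsE; rewrite rm; split=> //; case: (good_comp e gp).
Qed.

(** Sort the corners by their junction. A special vertex has one incoming and one outgoing arrow, so
    every nonzero path into it pairs with every nonzero path out of it. *)
Lemma corners_card (C : {fset qpath Q * qpath Q}) : (forall pq, pq \in C <-> corner pq) ->
  #|` C| = (\sum_(v : vertex Q | special K v) longest_to K v * longest_from K v)%N.
Proof.
move=> CP.
have fin (P : set (qpath Q)) : finite_set [set p | nonzero_paths Q K p /\ P p]%classic.
  by apply: sub_finite_set (good_finite hQ) => p [/nonzero_pathsE[]].
pose To v := fset_set [set p | nonzero_paths Q K p /\ ptgt p = v]%classic.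
pose From v := fset_set [set p | nonzero_paths Q K p /\ psrc p = v]%classic.
have ToP v p : p \in To v <-> nonzero_paths Q K p /\ ptgt p = v.
  exact: mem_fset_set (fin (fun p => ptgt p = v)).
have FromP v p : p \in From v <-> nonzero_paths Q K p /\ psrc p = v.
  exact: mem_fset_set (fin (fun p => psrc p = v)).
rewrite card_fset_sum1 big_seq.
rewrite (partition_big (fun pq => psrc pq.1) (special K)) /=; last first.
  move=> [p q] /CP[_ _ [a [b [_ sp cab]]]]; apply/specialP; exists a, b; split=> //.
    by rewrite (startsP sp).1; case: cab => /crel_comp.
  by rewrite (startsP sp).1.
apply: eq_bigr => v sv.
rewrite (longest_toE sv (ToP v)) (longest_fromE sv (FromP v)) mulnC.
transitivity (size [seq (p, q) | p <- From v, q <- To v]); last by rewrite size_allpairs.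
rewrite -big_seq_cond sum1_count -size_filter; apply/perm_size/uniq_perm.
- exact/filter_uniq/fset_uniq.
- by apply: allpairs_uniq => [||[p q] [p' q'] _ _]; rewrite ?fset_uniq.
move=> [p q]; rewrite mem_filter; apply/andP/allpairsP => /=.
  move=> [/eqP pv /CP[gp gq [a [b [eq sp [ab _ _]]]]]]; exists (p, q).
  split=> //; [apply/FromP|apply/ToP]; split=> //; try apply/nonzero_pathsE; try split=> //.
  - exact: plen_starts sp.
  - exact: plen_ends eq.
  - by rewrite (endsP eq).1 (crel_comp ab) -(startsP sp).1.
move=> [[p' q'] /= [/FromP[np pv] /ToP[nq qv] [-> ->]]]; split; first exact/eqP.
have /specialP[a [b [cab ta sb]]] := sv.
apply/CP; split; [by case/nonzero_pathsE: np|by case/nonzero_pathsE: nq|].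
exists a, b; split=> //.
  exact: special_paths_to sv nq qv _ ta.
exact: special_paths_from sv np pv _ sb.
Qed.

End Counting.

(** * Basis paths are the basic paths when there are at least two vertices *)

Section BasisPaths.
Variables (K : fieldType) (Q : quiver) (k : nat).
Hypothesis hQ : mutation_class_A Q k.
Implicit Types (p q r : qpath Q) (a b : arrow Q) (v : vertex Q).

Lemma exists_incident x : (1 < k)%N -> exists a, src a = x \/ tgt a = x.
Proof.
have [<- conn _ _] := hQ; move=> /card_gt1P[y [z [_ _ yz]]].
have [t tx] : exists t, t != x.
  by have [yx|] := eqVneq y x; [exists z; rewrite -yx eq_sym|exists y].
have /connectP[[|w s] /=] := conn x t; first by move=> _ /eqP; rewrite (negbTE tx).
move=> /andP[/existsP[a /orP[]/andP[/eqP e1 /eqP e2]] _] _; exists a; by [left|right].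
Qed.

(** A basic stationary path would sit at a vertex without arrows, which connectedness excludes. *)
Lemma basic_plen_gt0 p : (1 < k)%N -> basic p -> (0 < plen p)%N.
Proof.
move=> k1 [_ _ _ out inn]; case: (starts_or_stationary p) => [ps|[b /plen_starts //]].
have pt : ptgt p = psrc p by rewrite ps.
have [a [/out/plen_starts//|]] := exists_incident (psrc p) k1.
by rewrite -pt => /inn/plen_ends.
Qed.

Lemma valency1_source v b : valency v = 1%N -> src b = v ->
  (forall a, tgt a <> v) /\ (forall b', src b' = v -> b' = b).
Proof.
move=> v1 sb; have ob : b \in [set b | @src Q b == v] by rewrite inE sb.
have : (0 < #|[set b | @src Q b == v]|)%N by apply/card_gt0P; exists b.
move: v1; rewrite /valency; case E: #|[set b | _]| => [|[|n]] // [].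
rewrite add0n => /eqP; rewrite cards_eq0 => /eqP i0 _; split=> [a ta|b' sb'].
  by have : a \in [set a | @tgt Q a == v]; [rewrite inE ta|rewrite i0 inE].
have /eqP/cards1P[b0 Eb] := E.
have : b' \in [set b | @src Q b == v] by rewrite inE sb'.
by move: ob; rewrite Eb => /set1P -> /set1P ->.
Qed.

Lemma valency1_sink v a : valency v = 1%N -> tgt a = v ->
  (forall b, src b <> v) /\ (forall a', tgt a' = v -> a' = a).
Proof.
move=> v1 ta; have ia : a \in [set a | @tgt Q a == v] by rewrite inE ta.
have : (0 < #|[set a | @tgt Q a == v]|)%N by apply/card_gt0P; exists a.
move: v1; rewrite /valency addnC; case E: #|[set a | _]| => [|[|n]] // [].
rewrite add0n => /eqP; rewrite cards_eq0 => /eqP o0 _; split=> [b sb|a' ta'].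
  by have : b \in [set b | @src Q b == v]; [rewrite inE sb|rewrite o0 inE].
have /eqP/cards1P[a0 Ea] := E.
have : a' \in [set a | @tgt Q a == v] by rewrite inE ta'.
by move: ia; rewrite Ea => /set1P -> /set1P ->.
Qed.

(** If an arrow enters the source, left maximality relates every such arrow to b, so it is unique by
    [crel_injl] and the vertex is special. If none does, b is the only arrow there and the vertex is
    a source of valency one. *)
Lemma basis_end_src p b : good p -> starts b p ->
  basis_end K (psrc p) <-> left_maximal p /\ forall b', src b' = psrc p -> starts b' p.
Proof.
move=> gp sp; have [sb _] := startsP sp; split.
  case/orP => [/specialP[a [b0 [[ab ina outb] ta sb0]]]|/andP[/eqP v1 _]].
    have bb0 : b = b0 by apply: outb; rewrite sb0 sb.
    split=> [a' r e|b' sb']; last by rewrite (outb b') -?bb0 // sb' sb.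
    rewrite (good_starts sp gp e) negbK bb0 (ina a') //.
    by rewrite ta; apply: comp_junction e.
  have [ni uo] := valency1_source v1 (esym sb); split=> [a r e|b' sb'].
    by case: (ni a); apply: comp_junction e.
  by rewrite (uo b').
move=> [lp out]; have outb b' : src b' = psrc p -> b' = b.
  by move=> /out sp'; apply: starts_inj sp' sp.
have [[a ta]|na] := pselect (exists a, tgt a = psrc p).
  have ab : forall a', tgt a' = psrc p -> crel a' b.
    move=> a' /(pcomp_ex (p := arrow_path a'))[r e].
    by have := lp _ _ e; rewrite (good_starts sp gp e) negbK.
  apply/orP; left; apply/specialP; exists a, b; split=> //; split.
  - exact: ab.
  - by move=> a'; rewrite ta => ta'; apply: (crel_injl hQ (ab _ ta') (ab _ ta)).
  - by move=> b' sb'; apply: outb; rewrite sb' sb.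
apply/orP; right; apply/andP; split.
  rewrite /valency (_ : [set b | _] = [set b]) ?cards1.
    rewrite (_ : [set a | _] = finset.set0) ?cards0 //.
    by apply/setP=> a; rewrite !inE; apply/eqP=> ta; apply: na; exists a.
  by apply/setP=> b'; rewrite !inE; apply/eqP/eqP => [/outb|->].
apply/orP; left; apply/forallP=> a; apply/eqP=> ta; apply: na; by exists a.
Qed.

Lemma basis_end_tgt p a : good p -> ends a p ->
  basis_end K (ptgt p) <-> right_maximal p /\ forall a', tgt a' = ptgt p -> ends a' p.
Proof.
move=> gp ep; have [ta _] := endsP ep; split.
  case/orP => [/specialP[a0 [b [[ab ina outb] ta0 sb]]]|/andP[/eqP v1 _]].
    have aa0 : a = a0 by apply: ina; rewrite ta0 ta.
    split=> [b' r e|a' ta']; last by rewrite (ina a') -?aa0 // ta' ta.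
    rewrite (good_ends ep gp e) negbK aa0 (outb b') //.
    by rewrite sb; apply/esym/(comp_junction e).
  have [no ui] := valency1_sink v1 (esym ta); split=> [b r e|a' ta'].
    by case: (no b); apply/esym/(comp_junction e).
  by rewrite (ui a').
move=> [rp inn]; have ina a' : tgt a' = ptgt p -> a' = a.
  by move=> /inn ep'; apply: ends_inj ep' ep.
have [[b sb]|nb] := pselect (exists b, src b = ptgt p).
  have ab : forall b', src b' = ptgt p -> crel a b'.
    move=> b' /esym/(pcomp_ex (q := arrow_path b'))[r e].
    by have := rp _ _ e; rewrite (good_ends ep gp e) negbK.
  apply/orP; left; apply/specialP; exists a, b; split=> //; split.
  - exact: ab.
  - by move=> a' ta'; apply: ina; rewrite ta' ta.
  - by move=> b'; rewrite sb => sb'; apply: (crel_injr hQ (ab _ sb') (ab _ sb)).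
apply/orP; right; apply/andP; split.
  rewrite /valency (_ : [set a | tgt a == _] = [set a]) ?cards1.
    rewrite (_ : [set b | src b == _] = finset.set0) ?cards0 //.
    by apply/setP=> b; rewrite !inE; apply/eqP=> sb; apply: nb; exists b.
  by apply/setP=> a'; rewrite !inE; apply/eqP/eqP => [/ina|->].
apply/orP; right; apply/forallP=> b; apply/eqP=> sb; apply: nb; by exists b.
Qed.

Lemma basis_pathsE p : (1 < k)%N -> basis_paths Q K p <-> basic p.
Proof.
move=> k1; split=> [[/nonzero_pathsE[p0 gp] bs bt]|bp].
  have [[b sb] [a ea]] := (plen_gt0_starts p0, plen_gt0_ends p0).
  have [lp out] := (basis_end_src gp sb).1 bs.
  by have [rp inn] := (basis_end_tgt gp ea).1 bt.
have p0 := basic_plen_gt0 k1 bp; have [gp lp rp out inn] := bp.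
have [[b sb] [a ea]] := (plen_gt0_starts p0, plen_gt0_ends p0).
by split; [apply/nonzero_pathsE|apply/(basis_end_src gp sb)|apply/(basis_end_tgt gp ea)].
Qed.

End BasisPaths.

(** The finiteness claims guarantee that [dim] and [fset_set] do not take their default values. For
    k = 1 the algebra is K, of Frobenius dimension 1 because of the stationary path, while the
    right-hand side of the formula is 0. *)
Theorem theoremA (K : closedFieldType) (Q : quiver) (k : nat)
    (hQ : mutation_class_A Q k) :
  let A : algType K := saturated_algebra Q K in
  [/\ finite_dim (frobenius_space A),
      finite_set (nonzero_paths Q K)
    & (1 < k)%N ->
      Frobdim A = (#|` fset_set (basis_paths Q K)| +
        \sum_(b : vertex Q | special K b) longest_to K b * longest_from K b)%N].
Proof.
move=> A.
have fin (S : set (qpath Q)) : (forall p, S p -> good p) -> finite_set S.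
  by move=> sg; apply: sub_finite_set (good_finite hQ) => p /sg.
have finC : finite_set [set pq : qpath Q * qpath Q | corner pq]%classic.
  apply: sub_finite_set (finite_setX (good_finite hQ) (good_finite hQ)).
  by move=> [p q] [gp gq _].
set N := fset_set [set p : qpath Q | good p]%classic.
have NP p : (p \in N) = good p by apply/idP/idP => /(mem_fset_set _ (good_finite hQ)).
set B := fset_set [set p : qpath Q | basic p]%classic.
have BP p : p \in B <-> basic p by apply: mem_fset_set; apply: fin => q [].
set C := fset_set [set pq : qpath Q * qpath Q | corner pq]%classic.
have CP pq : pq \in C <-> corner pq by apply: mem_fset_set finC.
have dimA : has_dim (frobenius_space A) (#|` B| + #|` C|).
  apply: (@frobenius_path_dim K Q k A (@pathA K Q) (@pcoef K Q) N NP
    _ _ _ _ _ _ _ hQ B C BP CP).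
  - by move=> p q r e; rewrite pathAM e.
  - exact: pcoef_path.
  - exact: pcoefE NP.
  - exact: pcoef_mull.
  - exact: pcoef_mull0.
  - exact: pcoef_mulr.
  - exact: pcoef_mulr0.
split=> [||k1].
- by exists (#|` B| + #|` C|)%N.
- by apply: fin => p /nonzero_pathsE[].
rewrite /Frobdim (dimE dimA) (corners_card K hQ CP); congr (#|` _| + _)%N.
by congr fset_set; apply/seteqP; split=> p /(basis_pathsE K hQ p k1).
Qed.
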